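(* Let $t\ge 1$ be a fixed integer. For all sufficiently large $n$, if a complex $K\in\mathcal{K}(n,2,t)$ attains the maximum of $\mathfrak{q}_1$ over all complexes in $\mathcal{K}(n,2,t)$, then $K\in\mathcal{T}_n^{2,t}$ (up to relabeling of vertices), and $$\mathfrak{q}_1(K)=2n-3+\frac{9t}{n^3}+O\!\left(\frac{1}{n^4}\right)$$ as $n\to\infty$ (the implied constant depending on $t$).
   Context: A simplicial complex is a family of subsets of a finite vertex set closed under taking subsets; an $i$-face is a member of cardinality $i+1$ and $S_i(K)$ is the set of $i$-faces. $K$ is pure $2$-dimensional if all inclusion-maximal faces (facets) are $2$-faces. $\beta_2(K)=\dim H_2(K;\mathbb{R})$ (simplicial homology with real coefficients). $\mathcal{K}(n,2,t)$ is the set of pure $2$-dimensional complexes on $n$ vertices with $\beta_2=t$. For $f:S_1(K)\to\mathbb{R}$ and a $2$-face $F$, write $f(\partial F)=\sum_{G\in S_1(K),\,G\subset F}f(G)$ (sum over the three edges of $F$). The $1$-up signless Laplacian $Q_1^{up}(K)$ is the linear operator on $\mathbb{R}^{S_1(K)}$ given by $(Q_1^{up}(K)f)(G)=\sum_{F\in S_2(K):\,G\subset F} f(\partial F)$; it is a symmetric nonnegative matrix, and $\mathfrak{q}_1(K)$ denotes its largest eigenvalue (spectral radius), called the signless Laplacian spectral radius of $K$. The tented complex $\mathsf{T}_n^2$ is the pure $2$-dimensional complex on $[n]$ whose facets are all $3$-subsets of $[n]$ containing a fixed vertex; $\mathcal{T}_n^{2,t}$ is the set of complexes obtained from $\mathsf{T}_n^2$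 by adding $t$ additional $2$-faces. *)

(* Defs.v *)
From HB Require Import structures.
From mathcomp Require Import all_boot all_order all_fingroup all_algebra.
From mathcomp Require Import all_classical all_reals.

Set Implicit Arguments.
Unset Strict Implicit.
Unset Printing Implicit Defensive.

Import Order.TTheory GRing.Theory Num.Theory.
Local Open Scope ring_scope.

Section Complexes.
Variable n : nat.
Implicit Types (K L : {set {set 'I_n}}) (F G : {set 'I_n}).

Definition simplicial_complex K : bool :=
  [forall F in K, forall G : {set 'I_n}, (G \subset F) ==> (G \in K)].

(* An i-face has i + 1 elements; in particular the empty face is not counted
   in [faces 0 K], so that the homology below is not reduced. *)
Definition faces (i : nat) K : {set {set 'I_n}} := [set F in K | #|F| == i.+1].

Definition facets K : {set {set 'I_n}} :=
  [set F in K | [forall G in K, (F \subset G) ==> (G == F)]].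

Definition pure (d : nat) K : bool := facets K \subset faces d K.

Definition all_vertices K : bool := [forall v : 'I_n, [set v]%SET \in K].

Definition generated (A : {set {set 'I_n}}) : {set {set 'I_n}} :=
  [set G : {set 'I_n} | [exists F in A, G \subset F]].

Definition tented_facets (v : 'I_n) : {set {set 'I_n}} :=
  [set F : {set 'I_n} | (#|F| == 3%N) && (v \in F)].

Definition tented (v : 'I_n) : {set {set 'I_n}} := generated (tented_facets v).

Definition tented_plus (v : 'I_n) (t : nat) K : Prop :=
  exists A : {set {set 'I_n}},
    [/\ #|A| = t,
        forall F, F \in A -> #|F| = 3%N /\ F \notin tented v
      & K = generated (tented v :|: A)].

Definition relabel (s : {perm 'I_n}) K : {set {set 'I_n}} :=
  (fun F : {set 'I_n} => s @: F) @: K.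

Definition isomorphic K L : Prop := exists s : {perm 'I_n}, L = relabel s K.

End Complexes.

Section Homology.
Variables (R : realType) (n : nat).
Implicit Types (K : {set {set 'I_n}}) (F G : {set 'I_n}).

(* Faces are oriented by the order of 'I_n: the face obtained from
   {v_0 < ... < v_k} by deleting v_j has coefficient (-1)^j. *)
Definition incidence F G : R :=
  \sum_(v in F | G == (F :\ v)%SET) (-1) ^+ #|[set u in F | (u < v)%N]|.

(* Chains are row vectors, so the boundary acts by right multiplication.
   For k = 0 this is the zero map. *)
Definition boundary_mx K (k : nat) : 'M[R]_(#|faces k K|, #|faces k.-1 K|) :=
  \matrix_(i, j) incidence (enum_val i) (enum_val j).

(* dim (Z_k / B_k); since B_k is contained in Z_k when K is a complex, the
   subtraction is exact. *)
Definition betti K (k : nat) : nat :=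
  (\rank (kermx (boundary_mx K k)) - \rank (boundary_mx K k.+1))%N.

(* The family K(n,2,t): every one of the n vertices is a 0-face. *)
Definition complexes2 (t : nat) K : Prop :=
  [/\ simplicial_complex K, all_vertices K, pure 2 K & betti K 2 = t].

End Homology.

Section SignlessLaplacian.
Variables (R : realType) (n : nat) (K : {set {set 'I_n}}).

Definition edge := {G : {set 'I_n} | G \in faces 1 K}.

Definition bsum (f : {ffun edge -> R^o}) (F : {set 'I_n}) : R :=
  \sum_(G : edge | val G \subset F) f G.

Definition signless_up (f : {ffun edge -> R^o}) : {ffun edge -> R^o} :=
  [ffun G : edge =>
    \sum_(F in faces 2 K | val G \subset F) bsum f F : R^o].

Fact signless_up_is_linear : linear signless_up.
Proof.
move=> a f g; apply/ffunP => G; rewrite !ffunE scaler_sumr -big_split /=.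
apply: eq_bigr => F _; rewrite /bsum scaler_sumr -big_split /=.
by apply: eq_bigr => H _; rewrite !ffunE.
Qed.

HB.instance Definition _ :=
  GRing.isLinear.Build R {ffun edge -> R^o} {ffun edge -> R^o} *:%R
    signless_up signless_up_is_linear.

(* The set of eigenvalues is finite, and nonempty as soon as K has an edge
   (the operator is symmetric), so the supremum is then the largest one. *)
Definition signless_radius : R :=
  sup [set a : R | passmx.leigenvalue (linfun signless_up) a]%classic.

End SignlessLaplacian.

Definition maximizer (R : realType) (n t : nat) (K : {set {set 'I_n}}) : Prop :=
  complexes2 R t K /\
  forall L : {set {set 'I_n}},
    complexes2 R t L -> signless_radius R L <= signless_radius R K.

(* Main.v *)
Require Import Defs.
From mathcomp Require Import all_boot all_order all_fingroup all_algebra.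
From mathcomp Require Import all_classical all_reals.
From mathcomp Require Import topology normedtype derive.
From mathcomp Require Import ring lra.

(** The triangles of [K] are encoded by the symmetric ternary relation [tau K]
and edge functions by symmetric functions [f x y].  Let [q] be the radius,
[f >= 0] a Perron vector normalised so that the largest triangle sum
[f a b + f a c + f b c] is 1 and is attained at [abc], and let [d e] be the
number of triangles on the edge [e], so [q * f e <= d e].

Homology enters three times: every [x] for which [abx], [acx], [bcx] are all
triangles contributes an independent tetrahedral cycle, so there are at most [t]
of them; [K] has at most ['C(n-1, 2) + t] triangles, because a 1-cycle is
determined by its values off a vertex; and a tented complex with [t] triangles
added has Betti number [t], which with a trial vector gives
[q >= 2n - 3 + 9t/n^3].

Summing the eigenvalue equations of the triangles [abx], [acx], [bcx] over all
[x] and comparing with the number of triangles yields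
[d(ab)^2 + d(ac)^2 + d(bc)^2 >= 2n^2 - O(n)], whereas
[d(ab) + d(ac) + d(bc) <= 2n + t].  Hence the smallest of the three, say [d(bc)],
is bounded, and then all but [O(n)] of the triangles at [a] are present.  So [f]
is [O(1/n)] on edges avoiding [a] and sums to [n/2 - O(1)] over edges at [a].
Replacing all but [t] of the triangles avoiding [a] by the missing triangles at
[a] would increase the quadratic form, hence no triangle at [a] is missing.
Finally, pairing [f] with the Perron vector of the tented complex expresses
[q - (2n - 3)] as a ratio whose numerator is a sum over the [t] extra triangles. *)

Set Implicit Arguments.
Unset Strict Implicit.
Unset Printing Implicit Defensive.

Import Order.TTheory GRing.Theory Num.Theory.
Import numFieldNormedType.Exports.
Local Open Scope ring_scope.

(** * Ternary relations and link degrees *)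

Section TripleSums.
Variables (R : realFieldType) (n : nat).
Implicit Types (Phi : 'I_n -> 'I_n -> 'I_n -> R).

(** Vanishing is required only on [x x y]; the two transpositions carry it to every triple with a
    repeated vertex. *)
Definition sym3 (S : Type) (z0 : S) (Phi : 'I_n -> 'I_n -> 'I_n -> S) : Prop :=
  [/\ forall x y z, Phi x y z = Phi y x z,
      forall x y z, Phi x y z = Phi x z y
    & forall x y, Phi x x y = z0].

Lemma sum_predC1 (F : 'I_n -> R) v :
  F v = 0 -> \sum_(x | x != v) F x = \sum_x F x.
Proof. by move=> Fv; rewrite [RHS](bigD1 v) //= Fv add0r. Qed.

(** A triple with nonzero [Phi] contains [v] in at most one place, and by symmetry the three places
    contribute equally. *)
Lemma sum_triples_split Phi v : sym3 0 Phi ->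
  \sum_x \sum_y \sum_z Phi x y z
  = 3%:R * (\sum_x \sum_y Phi v x y)
    + \sum_(x | x != v) \sum_(y | y != v) \sum_(z | z != v) Phi x y z.
Proof.
move=> [P12 P23 P0].
rewrite (bigD1 v) //=.
have -> : \sum_(x | x != v) \sum_y \sum_z Phi x y z =
   2%:R * (\sum_x \sum_y Phi v x y) +
   \sum_(x | x != v) \sum_(y | y != v) \sum_(z | z != v) Phi x y z.
  transitivity (\sum_(x | x != v) (\sum_y Phi v x y + \sum_y Phi v x y
     + \sum_(y | y != v) \sum_(z | z != v) Phi x y z)).
    apply: eq_bigr => x xv.
    rewrite (bigD1 v) //= -addrA; congr (_ + _); first by apply: eq_bigr => z _.
    transitivity (\sum_(y | y != v)
        (Phi v x y + \sum_(z | z != v) Phi x y z)).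
      by apply: eq_bigr => y yv; rewrite (bigD1 v) //= P23 P12.
    by rewrite big_split /= sum_predC1 // P23 P0.
  rewrite !big_split /= sum_predC1; first by ring.
  by apply: big1 => y _; rewrite P0.
by ring.
Qed.

End TripleSums.

Section LinkDegrees.
Variables (R : realFieldType) (n : nat) (tau : 'I_n -> 'I_n -> 'I_n -> bool).

Definition face_wt x y z : R := (tau x y z)%:R.
Definition edge_deg x y : R := \sum_z face_wt x y z.
(** For symmetric [tau] this runs over ordered pairs, so it is twice the number of triangles at
    [x]. *)
Definition link_size x : R := \sum_y edge_deg x y.
Definition tri (f : 'I_n -> 'I_n -> R) x y z : R := f x y + f x z + f y z.

Hypothesis tau_sym : sym3 false tau.

Lemma wt_ge0 x y z : 0 <= face_wt x y z. Proof. by rewrite /face_wt ler0n. Qed.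
Lemma wt_le1 x y z : face_wt x y z <= 1. Proof. by rewrite /face_wt lern1 leq_b1. Qed.

Lemma wt_sym : sym3 0 face_wt.
Proof.
have [t1 t2 t3] := tau_sym.
by split=> *; rewrite /face_wt; [rewrite t1|rewrite t2|rewrite t3].
Qed.

Lemma wtC x y z : face_wt x y z = face_wt y x z. Proof. by have [] := wt_sym. Qed.
Lemma wtCA x y z : face_wt x y z = face_wt x z y. Proof. by have [] := wt_sym. Qed.
Lemma wtxx x y : face_wt x x y = 0. Proof. by have [] := wt_sym. Qed.
Lemma wtxyx x y : face_wt x y x = 0. Proof. by rewrite wtCA wtxx. Qed.
Lemma wtxyy x y : face_wt x y y = 0. Proof. by rewrite wtC wtxyx. Qed.

Lemma wt_cases x y z : face_wt x y z = 0 \/ face_wt x y z = 1 /\ tau x y z.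
Proof. by rewrite /face_wt; case: tau; [right|left]. Qed.

Lemma degC x y : edge_deg x y = edge_deg y x.
Proof. by apply: eq_bigr => z _; rewrite wtC. Qed.
Lemma degxx x : edge_deg x x = 0.
Proof. by apply: big1 => z _; rewrite wtxx. Qed.
Lemma deg_ge0 x y : 0 <= edge_deg x y.
Proof. by apply: sumr_ge0 => z _; exact: wt_ge0. Qed.

Lemma sum_const_ord (c : R) : \sum_(x < n) c = n%:R * c.
Proof. by rewrite sumr_const card_ord mulr_natl. Qed.

Lemma deg_le x y : edge_deg x y <= (n - 2)%:R.
Proof.
have [<-|xy] := eqVneq x y; first by rewrite degxx ler0n.
apply: (@le_trans _ _ (\sum_(z | z \notin [set x; y]) 1)).
  rewrite /edge_deg (bigID (mem [set x; y])) /= big1 ?add0r; last first.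
    by move=> z; rewrite !inE => /orP[] /eqP->; rewrite ?wtxyx ?wtxyy.
  by apply: ler_sum => z _; exact: wt_le1.
rewrite sumr_const ler_nat.
have -> : #|[pred z | z \notin [set x; y]]| = #|~: [set x; y]|.
  by apply: eq_card => z; rewrite !inE.
by rewrite cardsCs finset.setCK cards2 xy card_ord.
Qed.

(* A triple containing k of the three vertices is counted k times on the left,
   and k <= 1 + 'C(k, 2). *)
Lemma ldeg_sum3_le a b c : a != b -> a != c -> b != c ->
  3%:R * (link_size a + link_size b + link_size c)
  <= \sum_x \sum_y \sum_z face_wt x y z
     + 6%:R * (edge_deg a b + edge_deg a c + edge_deg b c).
Proof.
move=> ab ac bc.
(* The indicator of [{a, b, c}], written as a sum so that weighting by it evaluates at the three
   vertices. *)
pose al x : R := (x == a)%:R + (x == b)%:R + (x == c)%:R.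
have al01 x : al x = 0 \/ al x = 1.
  rewrite /al.
  have [->|xa] := eqVneq x a; first by rewrite (negPf ab) (negPf ac) /=; right; ring.
  have [->|xb] := eqVneq x b; first by rewrite (negPf bc) /=; right; ring.
  by case: eqVneq => _ /=; [right|left]; ring.
have alE (F : 'I_n -> R) : \sum_x al x * F x = F a + F b + F c.
  rewrite /al.
  under eq_bigr do rewrite !mulrDl !mulr_natl !mulrb.
  by rewrite !big_split /= -!big_mkcond !big_pred1_eq.
have E1 : \sum_x \sum_y \sum_z face_wt x y z * al x = link_size a + link_size b + link_size c.
  rewrite -(alE link_size); apply: eq_bigr => x _.
  rewrite /link_size /edge_deg mulr_sumr; apply: eq_bigr => y _.
  by rewrite mulr_sumr; apply: eq_bigr => z _; rewrite mulrC.
have E2 : \sum_x \sum_y \sum_z face_wt x y z * al y = link_size a + link_size b + link_size c.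
  rewrite exchange_big /= -E1; apply: eq_bigr => x _; apply: eq_bigr => y _.
  by apply: eq_bigr => z _; rewrite wtC.
have E3 : \sum_x \sum_y \sum_z face_wt x y z * al z = link_size a + link_size b + link_size c.
  rewrite -E2; apply: eq_bigr => x _.
  rewrite exchange_big /=; apply: eq_bigr => y _.
  by apply: eq_bigr => z _; rewrite wtCA.
have E4 : \sum_x \sum_y \sum_z face_wt x y z * (al x * al y)
    = 2%:R * (edge_deg a b + edge_deg a c + edge_deg b c).
  transitivity (\sum_x al x * (\sum_y al y * edge_deg x y)).
    apply: eq_bigr => x _; rewrite mulr_sumr; apply: eq_bigr => y _.
    rewrite mulrA /edge_deg mulr_sumr; apply: eq_bigr => z _.
    by rewrite mulrC.
  rewrite alE !alE !degxx (degC b a) (degC c a) (degC c b); ring.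
have E5 : \sum_x \sum_y \sum_z face_wt x y z * (al x * al z)
    = 2%:R * (edge_deg a b + edge_deg a c + edge_deg b c).
  rewrite -E4; apply: eq_bigr => x _.
  rewrite exchange_big /=; apply: eq_bigr => y _.
  by apply: eq_bigr => z _; rewrite wtCA.
have E6 : \sum_x \sum_y \sum_z face_wt x y z * (al y * al z)
    = 2%:R * (edge_deg a b + edge_deg a c + edge_deg b c).
  rewrite exchange_big /= -E5; apply: eq_bigr => x _; apply: eq_bigr => y _.
  by apply: eq_bigr => z _; rewrite wtC.
have -> : 3%:R * (link_size a + link_size b + link_size c) =
   \sum_x \sum_y \sum_z face_wt x y z * (al x + al y + al z).
  transitivity (\sum_x \sum_y \sum_z
      (face_wt x y z * al x + face_wt x y z * al y + face_wt x y z * al z)).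
    under [RHS]eq_bigr do under eq_bigr do rewrite !big_split /=.
    under [RHS]eq_bigr do rewrite !big_split /=.
    by rewrite !big_split /= E1 E2 E3; ring.
  by do 3!(apply: eq_bigr => ? _); rewrite !mulrDr.
have -> : \sum_x \sum_y \sum_z face_wt x y z + 
    6%:R * (edge_deg a b + edge_deg a c + edge_deg b c) =
   \sum_x \sum_y \sum_z (face_wt x y z + face_wt x y z * (al x * al y)
      + face_wt x y z * (al x * al z) + face_wt x y z * (al y * al z)).
  under [RHS]eq_bigr do under eq_bigr do rewrite !big_split /=.
  under [RHS]eq_bigr do rewrite !big_split /=.
  by rewrite !big_split /= E4 E5 E6; ring.
apply: ler_sum => x _; apply: ler_sum => y _; apply: ler_sum => z _.
rewrite -[X in _ <= X + _ + _ + _]mulr1 -!mulrDr.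
apply: ler_wpM2l; first exact: wt_ge0.
by move: (al01 x) (al01 y) (al01 z) => [->|->] [->|->] [->|->]; lra.
Qed.

End LinkDegrees.

(** * A vertex with almost complete link *)

(** Since [d1] and [d2] are at most [nu], the sum of squares is at most
    [nu * (2 * nu + t - d3) + d3 ^ 2], while the bounds on [q] and [D] keep it above
    [2 * nu ^ 2 - O(nu)]. Hence [d3 * (nu - d3)] is [O(nu)]. *)
Lemma small_third_degree (R : realFieldType) (nu t q d1 d2 d3 D : R) :
  0 <= t -> 4%:R <= nu -> 4%:R * t <= nu ->
  0 <= d3 -> d3 <= d1 -> d3 <= d2 -> d1 <= nu -> d2 <= nu ->
  d1 + d2 + d3 <= 2%:R * nu + t -> 2%:R * nu - 3%:R <= q ->
  q ^+ 2 - nu ^+ 2 - (d1 ^+ 2 + d2 ^+ 2 + d3 ^+ 2) - 2%:R * nu * t <= D ->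
  D <= (nu - 1) * (nu - 2%:R) + 2%:R * t + 2%:R * (2%:R * nu + t) ->
  d3 <= 78%:R + 24%:R * t.
Proof.
move=> t0 n4 nt d30 d31 d32 d1n d2n dsum qn D1 D2.
have q2 : (2%:R * nu - 3%:R) ^+ 2 <= q ^+ 2 by rewrite ler_pXn2r // nnegrE; lra.
have p1 : 0 <= d1 * (nu - d1) by apply: mulr_ge0; lra.
have p2 : 0 <= d2 * (nu - d2) by apply: mulr_ge0; lra.
have p3 : 0 <= nu * (2%:R * nu + t - d1 - d2 - d3) by apply: mulr_ge0; lra.
have p4 : 0 <= t * (nu - 4%:R) by apply: mulr_ge0; lra.
(* The smallest degree is at most [(2 * nu + t) / 3], below [5 * nu / 6] because [4 * t <= nu]. The
   resulting factor 6 turns [d3 * (nu - d3) <= (13 + 4 * t) * nu] into [d3 <= 78 + 24 * t]. *)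
have p5 : 0 <= d3 * (nu - d3 - nu / 6%:R) by apply: mulr_ge0; lra.
have : nu * d3 <= nu * (78%:R + 24%:R * t) by lra.
by rewrite ler_pM2l //; lra.
Qed.

Section StarVertex.
Variables (R : realFieldType) (n : nat) (tau : 'I_n -> 'I_n -> 'I_n -> bool).
Hypothesis tau_sym : sym3 false tau.
Variables (f : 'I_n -> 'I_n -> R) (q : R) (t : nat).
Hypothesis fC : forall x y, f x y = f y x.
Hypothesis f_ge0 : forall x y, 0 <= f x y.
Hypothesis eig : forall x y, q * f x y = \sum_z face_wt R tau x y z * tri f x y z.
Hypothesis tri_le1 : forall x y z, tau x y z -> tri f x y z <= 1.

Local Notation wt := (face_wt R tau).
Local Notation deg := (edge_deg R tau).
Local Notation ldeg := (link_size R tau).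
Local Notation nu := (n%:R : R).

Lemma tri_ge0 x y z : 0 <= tri f x y z.
Proof. by rewrite /tri !addr_ge0. Qed.

Lemma wt_tri_le x y z : wt x y z * tri f x y z <= wt x y z.
Proof.
have [->|[-> txyz]] := wt_cases R tau x y z; first by rewrite mul0r.
by rewrite mul1r tri_le1.
Qed.

Lemma eig_le_deg x y : q * f x y <= deg x y.
Proof. by rewrite eig; apply: ler_sum => z _; exact: wt_tri_le. Qed.

Lemma q_tri_le x y z : q * tri f x y z <= deg x y + deg x z + deg y z.
Proof. by rewrite /tri !mulrDr !lerD // eig_le_deg. Qed.

Lemma deg_le_n x y : deg x y <= nu.
Proof. by apply: le_trans (deg_le R tau_sym x y) _; rewrite ler_nat leq_subr. Qed.

Hypothesis tetra : forall a b c, tau a b c ->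
  (#|[set w | [&& tau a b w, tau a c w & tau b c w]]| <= t)%N.
Hypothesis triples :
  \sum_x \sum_y \sum_z wt x y z
  <= 3%:R * (nu - 1) * (nu - 2%:R) + 6%:R * t%:R.

Lemma tau_neq a b c : tau a b c -> [/\ a != b, a != c & b != c].
Proof.
have [t12 t23 t0] := tau_sym => tabc.
split; apply/eqP => e; move: tabc; rewrite e ?t0 //.
  by rewrite t23 t0.
by rewrite t12 t23 t0.
Qed.

Lemma tetra_sum a b c : tau a b c ->
  \sum_w wt a b w * wt a c w * wt b c w <= t%:R.
Proof.
move=> /tetra tabc.
apply: le_trans (_ : #|[set w | [&& tau a b w, tau a c w & tau b c w]]|%:R <= _);
  last by rewrite ler_nat.
rewrite -sum1_card natr_sum [leRHS]big_mkcond /=; apply: ler_sum => w _; rewrite inE.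
by rewrite /face_wt; case: (tau a b w); case: (tau a c w); case: (tau b c w);
  rewrite /= ?(mul0r,mulr0,mulr1).
Qed.

(** A vertex [w] forms triangles with at most two of the edges [ab], [ac], [bc], unless [abcw] is a
    full tetrahedral boundary, which happens at most [t] times. *)
Lemma deg_sum3_le a b c : tau a b c ->
  deg a b + deg a c + deg b c <= 2%:R * nu + t%:R.
Proof.
move=> tabc; rewrite /edge_deg -!big_split /=.
apply: le_trans (_ : \sum_(w < n) (2%:R + wt a b w * wt a c w * wt b c w) <= _).
  apply: ler_sum => w _; rewrite /face_wt.
  by case: (tau a b w); case: (tau a c w); case: (tau b c w);
    rewrite /= ?(mul0r,mulr0,mulr1,mulr1n,mulr0n); lra.
rewrite big_split /= sum_const_ord mulrC.
by rewrite lerD2l tetra_sum.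
Qed.

Lemma radius_le a b c : tau a b c -> tri f a b c = 1 -> q <= 2%:R * nu + t%:R.
Proof.
move=> tabc g1; apply: le_trans (deg_sum3_le tabc).
by apply: le_trans (q_tri_le a b c); rewrite g1 mulr1.
Qed.

(** Iterates the eigenvalue equation: [q ^ 2] is the sum over [x] of [q * tri] on the triangles
    [abx], [acx], [bcx], and [q_tri_le] bounds each of them by the degrees of its three edges. *)
Lemma vertex_degree_sum_ge a b c : tau a b c -> tri f a b c = 1 ->
  q ^+ 2 - nu ^+ 2 - (deg a b ^+ 2 + deg a c ^+ 2 + deg b c ^+ 2)
    - 2%:R * nu * t%:R
  <= ldeg a + ldeg b + ldeg c.
Proof.
move=> tabc g1.
rewrite !lerBlDr.
have -> : q ^+ 2 = \sum_x q * (wt a b x * tri f a b x + wt a c x * tri f a c x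
                               + wt b c x * tri f b c x).
  rewrite -mulr_sumr !big_split /= -!eig -!mulrDr.
  by rewrite -/(tri f a b c) g1 mulr1.
have -> : ldeg a + ldeg b + ldeg c + 2%:R * nu * t%:R +
    (deg a b ^+ 2 + deg a c ^+ 2 + deg b c ^+ 2) + nu ^+ 2 =
  2%:R * nu * t%:R + \sum_x (deg a x + deg b x + deg c x +
    (deg a b * wt a b x + deg a c * wt a c x + deg b c * wt b c x) + nu).
  rewrite !big_split /= -!mulr_sumr sum_const_ord; rewrite /link_size /edge_deg; ring.
(* With two triangles present at [x], the degree of their common edge at [x] is counted once too
   often, at a cost of at most [nu]. With all three present the cost is at most [3 * nu], and the
   tetrahedron term supplies the extra [2 * nu]. *)
apply: le_trans (_ : \sum_x (2%:R * nu * (wt a b x * wt a c x * wt b c x)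
  + (deg a x + deg b x + deg c x +
    (deg a b * wt a b x + deg a c * wt a c x + deg b c * wt b c x) + nu)) <= _); last first.
  rewrite big_split /= lerD2r -mulr_sumr ler_wpM2l ?tetra_sum //.
  by rewrite mulr_ge0 ?ler0n.
apply: ler_sum => x _.
have := q_tri_le a b x; have := q_tri_le a c x; have := q_tri_le b c x.
have := deg_le_n a x; have := deg_le_n b x; have := deg_le_n c x.
have := deg_ge0 R tau a x; have := deg_ge0 R tau b x; have := deg_ge0 R tau c x.
move=> *.
move: (wt_cases R tau a b x) (wt_cases R tau a c x) (wt_cases R tau b c x)
  => [->|[-> _]] [->|[-> _]] [->|[-> _]]; lra.
Qed.

Hypothesis q_ge : 2%:R * nu - 3%:R <= q.
Hypothesis n4 : 4%:R <= nu.
Hypothesis nt : 4%:R * t%:R <= nu.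

Lemma ldeg_sum_le a b c : tau a b c ->
  ldeg a + ldeg b + ldeg c
  <= (nu - 1) * (nu - 2%:R) + 2%:R * t%:R + 2%:R * (2%:R * nu + t%:R).
Proof.
move=> tabc; have [ab ac bc] := tau_neq tabc.
have := ldeg_sum3_le R tau_sym ab ac bc.
have := deg_sum3_le tabc; move: triples; lra.
Qed.

Lemma min_deg_le a b c : tau a b c -> tri f a b c = 1 ->
  deg b c <= deg a b -> deg b c <= deg a c -> deg b c <= 78%:R + 24%:R * t%:R.
Proof.
move=> tabc g1 m1 m2.
apply: (small_third_degree (nu := nu) (q := q) (d1 := deg a b) (d2 := deg a c)
  (D := ldeg a + ldeg b + ldeg c)) => //;
  rewrite ?ler0n ?deg_ge0 ?deg_le_n //.
- exact: deg_sum3_le.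
- exact: vertex_degree_sum_ge.
- exact: ldeg_sum_le.
Qed.

Lemma ldeg_pair_ge a b : q * (q * f a b) <= deg a b ^+ 2 + ldeg a + ldeg b.
Proof.
rewrite {1}eig mulr_sumr expr2 {1}/edge_deg mulr_suml -addrA -!big_split /=.
apply: ler_sum => x _.
have := q_tri_le a b x.
have := deg_ge0 R tau a x; have := deg_ge0 R tau b x.
move: (wt_cases R tau a b x) => [->|[-> _]]; lra.
Qed.

(** With [deg b c] bounded, [q * f a b] and [q * f a c] are both [nu - O(1)], because the three
    values add up to [q >= 2 * nu - 3] and none exceeds [nu]. Then [ldeg_pair_ge] bounds
    [ldeg a + ldeg b] and [ldeg a + ldeg c] from below. *)
Lemma ldeg_star_ge a b c : tau a b c -> tri f a b c = 1 ->
  deg b c <= deg a b -> deg b c <= deg a c ->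
  81%:R + 24%:R * t%:R <= nu ->
  nu ^+ 2 - (333%:R + 96%:R * t%:R) * nu <= ldeg a.
Proof.
move=> tabc g1 m1 m2 nbig.
have d3 := min_deg_le tabc g1 m1 m2.
move: q_ge n4 nt => q_ge' n4' nt'.
have q0 : 0 <= q by lra.
have key e e' : 0 <= deg e e' -> deg e e' <= nu ->
   nu - 3%:R - (78%:R + 24%:R * t%:R) <= q * f e e' ->
   nu ^+ 2 - (165%:R + 48%:R * t%:R) * nu <= ldeg e + ldeg e'.
  move=> d0 dn qf.
  have := ldeg_pair_ge e e'.
  have p1 : 0 <= (q - (2%:R * nu - 3%:R)) * (q * f e e').
    by apply: mulr_ge0; lra.
  have p2 : 0 <= (2%:R * nu - 3%:R)
      * (q * f e e' - (nu - 3%:R - (78%:R + 24%:R * t%:R))).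
    by apply: mulr_ge0; lra.
  have p3 : 0 <= (nu - deg e e') * (nu + deg e e') by apply: mulr_ge0; lra.
  have t0 : 0 <= t%:R :> R by rewrite ler0n.
  have n0 : 0 <= nu by lra.
  lra.
have e1 : q * f a b + q * f a c + q * f b c = q.
  by rewrite -!mulrDr -/(tri f a b c) g1 mulr1.
have h1 := eig_le_deg a b; have h2 := eig_le_deg a c; have h3 := eig_le_deg b c.
have h4 := deg_le_n a b; have h5 := deg_le_n a c.
have k1 : nu ^+ 2 - (165%:R + 48%:R * t%:R) * nu <= ldeg a + ldeg b.
  by apply: key; rewrite ?deg_ge0 //; lra.
have k2 : nu ^+ 2 - (165%:R + 48%:R * t%:R) * nu <= ldeg a + ldeg c.
  by apply: key; rewrite ?deg_ge0 //; lra.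
(* Adding the two pair bounds and subtracting the upper bound for all three vertices isolates
   [ldeg a]. The constant 333 is twice 165 plus 3 for the lower-order terms. *)
have := ldeg_sum_le tabc.
lra.
Qed.

End StarVertex.

(** * The Perron vector near a tented complex *)

Section NearTent.
Variables (R : realFieldType) (n : nat) (tau : 'I_n -> 'I_n -> 'I_n -> bool).
Hypothesis tau_sym : sym3 false tau.
Variables (f : 'I_n -> 'I_n -> R) (q : R) (t : nat).
Hypothesis fC : forall x y, f x y = f y x.
Hypothesis f_ge0 : forall x y, 0 <= f x y.
Hypothesis eig : forall x y, q * f x y = \sum_z face_wt R tau x y z * tri f x y z.
Hypothesis tri_le1 : forall x y z, tau x y z -> tri f x y z <= 1.

Local Notation wt := (face_wt R tau).
Local Notation deg := (edge_deg R tau).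
Local Notation ldeg := (link_size R tau).
Local Notation nu := (n%:R : R).

Hypothesis triples :
  \sum_x \sum_y \sum_z wt x y z
  <= 3%:R * (nu - 1) * (nu - 2%:R) + 6%:R * t%:R.
Hypothesis q_ge : 2%:R * nu - 3%:R <= q.
Hypothesis q_le : q <= 2%:R * nu + t%:R.
Hypothesis n4 : 4%:R <= nu.
Hypothesis nt : 4%:R * t%:R <= nu.

Variables (v b c : 'I_n) (k : R).
Hypothesis tau_vbc : tau v b c.
Hypothesis tri_vbc : tri f v b c = 1.
Hypothesis k_ge0 : 0 <= k.
Hypothesis ldeg_v : nu ^+ 2 - k * nu <= ldeg v.

Lemma q_gt0 : 0 < q. Proof. by move: q_ge n4; lra. Qed.

Lemma perron_diag x : f x x = 0.
Proof.
have : q * f x x = 0.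
  by rewrite eig big1 // => z _; rewrite (wtxx R tau_sym) mul0r.
by move/eqP; rewrite mulf_eq0 gt_eqF ?q_gt0 //= => /eqP.
Qed.

Lemma deg_le_nu x y : deg x y <= nu - 2%:R.
Proof.
have n2 : (2 <= n)%N by rewrite -(ler_nat R); move: n4; lra.
by have := deg_le R tau_sym x y; rewrite natrB.
Qed.

(** Here [q * f x y <= nu - 2], whereas [q / 2 >= nu - 3 / 2]. *)
Lemma f_le_half x y : f x y <= 1 / 2%:R.
Proof.
have h1 := eig_le_deg eig tri_le1 x y; have h2 := deg_le_nu x y.
rewrite leNgt; apply/negP => h3.
have : 0 < q * (f x y - 1 / 2%:R) by rewrite mulr_gt0 ?q_gt0 ?subr_gt0.
by move: q_ge; lra.
Qed.

(** Ordered counting: [off_sum] is six times the number of triangles avoiding [v], and [missing] is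
    twice the number of absent triangles at [v]. *)
Definition off_sum : R :=
  \sum_(x | x != v) \sum_(y | y != v) \sum_(z | z != v) wt x y z.
Definition missing : R := (nu - 1) * (nu - 2%:R) - ldeg v.

(** The bound on all triangles says that those avoiding [v] outnumber those missing at [v] by at
    most [t]. *)
Lemma off_sum_le_missing : off_sum <= 3%:R * missing + 6%:R * t%:R.
Proof.
have := sum_triples_split v (wt_sym R tau_sym).
by move: triples; rewrite /off_sum /missing /link_size /edge_deg; lra.
Qed.

Lemma off_sum_le : off_sum <= (3%:R * k + 2%:R) * nu.
Proof. by have := off_sum_le_missing; move: nt n4 ldeg_v; rewrite /missing; lra. Qed.

Lemma off_sum_ge u : u != v ->
  \sum_(y | y != v) \sum_(z | z != v) wt u y z <= off_sum.
Proof.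
move=> uv; rewrite /off_sum [leRHS](bigD1 u) //= lerDl.
by do 3!(apply: sumr_ge0 => ? _); apply: wt_ge0.
Qed.

(** A triangle on [ux] either is [uxv], at most one for each [x], or avoids [v]. So the degrees of
    the edges [ux] sum to at most [nu + off_sum], which is [O(nu)], and dividing by [q >= nu] leaves
    a constant. *)
Lemma sum_f_off u : u != v -> \sum_(x | x != v) f u x <= 3%:R * k + 3%:R.
Proof.
move=> uv.
have h : q * \sum_(x | x != v) f u x <= nu + off_sum.
  rewrite mulr_sumr.
  apply: le_trans (_ : \sum_(x | x != v) (wt u x v + \sum_(z | z != v) wt u x z) <= _).
    apply: ler_sum => x xv; apply: le_trans (eig_le_deg eig tri_le1 u x) _.
    by rewrite /edge_deg (bigD1 v).
  rewrite big_split /= lerD ?off_sum_ge // -[nu]mulr1 -sum_const_ord big_mkcond /=.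
  by apply: ler_sum => x _; case: ifP => _; rewrite ?wt_le1.
have := off_sum_le; set S := \sum_(x | _) _ in h * => h2.
have S0 : 0 <= S by apply: sumr_ge0.
rewrite leNgt; apply/negP => h3.
have p1 : 0 <= (q - nu) * S by apply: mulr_ge0 => //; move: q_ge n4; lra.
have p2 : 0 < nu * (S - (3%:R * k + 3%:R)) by apply: mulr_gt0; move: n4; lra.
lra.
Qed.

(** In the eigenvalue equation at [uw] the value [f u w] recurs up to [deg u w] times; moved to the
    left, it leaves the factor [q - deg u w >= nu / 2]. The rest is at most 1 from the triangle
    through [v] plus two sums bounded by [sum_f_off]. *)
Lemma f_off_le u w : u != v -> w != v -> nu * f u w <= 12%:R * k + 14%:R.
Proof.
move=> uv wv.
have := eig u w; rewrite (bigD1 v) //=.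
have h1 : wt u w v * tri f u w v <= 1.
  by apply: le_trans (wt_tri_le tri_le1 _ _ _) (wt_le1 _ _ _ _ _).
have h2 : \sum_(z | z != v) wt u w z * tri f u w z
   <= deg u w * f u w + (3%:R * k + 3%:R) + (3%:R * k + 3%:R).
  apply: le_trans (_ : \sum_(z | z != v) (wt u w z * f u w + f u z + f w z) <= _).
    apply: ler_sum => z _; rewrite /tri !mulrDr -!addrA lerD2l lerD //.
      by rewrite ler_piMl // wt_le1.
    by rewrite ler_piMl // wt_le1.
  rewrite !big_split /= !lerD ?sum_f_off // /edge_deg mulr_suml.
  rewrite [leRHS](bigD1 v) //= lerDr mulr_ge0 // wt_ge0.
have h3 := deg_le_nu u w.
have p : 0 <= (q - deg u w - nu / 2%:R) * f u w.
  by apply: mulr_ge0 => //; move: q_ge n4; lra.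
by move=> h4; lra.
Qed.

Local Notation k4 := (12%:R * k + 14%:R).

Lemma f_vb_ge : nu / 2%:R - k4 <= nu * f v b.
Proof.
have [vb vc bc] := tau_neq tau_sym tau_vbc.
have h1 : nu * f b c <= k4 by apply: f_off_le; rewrite eq_sym.
have h2 := f_le_half v c.
have : nu * f v b + nu * f v c + nu * f b c = nu.
  by rewrite -!mulrDr -/(tri f v b c) tri_vbc mulr1.
have : 0 <= nu * (1 / 2%:R - f v c) by apply: mulr_ge0; rewrite ?ler0n ?subr_ge0.
lra.
Qed.

(** In each triangle [vuw] the side [uw] avoids [v] and weighs at most [k4 / nu], so these sides
    together cost only [k4]. *)
Lemma star_eig_le u : u != v ->
  (q - deg v u) * f v u <= \sum_w wt v u w * f v w + k4.
Proof.
move=> uv.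
have n0 : 0 < nu by move: n4; lra.
rewrite -(ler_pM2l n0).
have -> : nu * ((q - deg v u) * f v u) =
   \sum_w wt v u w * (nu * f v w) + \sum_w wt v u w * (nu * f u w).
  rewrite mulrBl eig /edge_deg mulr_suml -sumrB mulr_sumr -big_split /=.
  by apply: eq_bigr => w _; rewrite /tri; ring.
rewrite mulrDr lerD //.
  by rewrite mulr_sumr; apply: ler_sum => w _; rewrite mulrCA.
rewrite -[leRHS]sum_const_ord; apply: ler_sum => w _.
have [->|wv] := eqVneq w v.
  by rewrite (wtxyx R tau_sym) mul0r; move: k_ge0; lra.
apply: le_trans (f_off_le uv wv).
by rewrite ler_piMl ?wt_le1 // mulr_ge0 ?ler0n.
Qed.

Local Notation k5 := (24%:R * k + 29%:R).

(** The equation at [vb] gives [(nu - 1) * f v b <= \sum_w f v w + k4], and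
    [nu * f v b >= nu / 2 - k4]. The two errors [k4] and the loss [f v b <= 1 / 2] fit into [k5]. *)
Lemma star_sum_ge : nu / 2%:R - k5 <= \sum_w f v w.
Proof.
have [vb vc bc] := tau_neq tau_sym tau_vbc.
have bv : b != v by rewrite eq_sym.
have h1 := f_vb_ge; have h2 := star_eig_le bv; have h3 := deg_le_nu v b.
have h4 := f_le_half v b.
have h5 : \sum_w wt v b w * f v w <= \sum_w f v w.
  by apply: ler_sum => w _; rewrite ler_piMl ?wt_le1.
have : 0 <= (q - deg v b - (nu - 1)) * f v b.
  by apply: mulr_ge0 => //; move: q_ge; lra.
by move: k_ge0; lra.
Qed.

Lemma star_defect : \sum_w (1 / 2%:R - f v w) <= k5.
Proof. by rewrite sumrB sum_const_ord; have := star_sum_ge; lra. Qed.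

Definition miss u : R := \sum_(w | (w != v) && (w != u)) (1 - wt v u w).

Lemma sum_off_const u : u != v ->
  \sum_(w | (w != v) && (w != u)) (1 : R) = nu - 2%:R.
Proof.
move=> uv.
have := sum_const_ord n (1 : R).
rewrite mulr1 (bigD1 v) //= (bigD1 u) //= => h.
by move: h; lra.
Qed.

Lemma missE u : u != v -> miss u = nu - 2%:R - deg v u.
Proof.
move=> uv; rewrite /miss sumrB sum_off_const //; congr (_ - _).
rewrite /edge_deg [RHS](bigD1 v) //= [X in _ = _ + X](bigD1 u) //=.
by rewrite (wtxyx R tau_sym) (wtxyy R tau_sym) !add0r.
Qed.

Lemma missingE : missing = \sum_(u | u != v) miss u.
Proof.
rewrite (eq_bigr (fun u => (nu - 2%:R) - deg v u)); last by move=> u /missE.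
rewrite sumrB /missing; congr (_ - _).
  have := sum_const_ord n (nu - 2%:R); rewrite (bigD1 v) //=; lra.
by rewrite sum_predC1 // degxx.
Qed.

Hypothesis n_big : 3%:R * t%:R + 64%:R * k5 + 15%:R <= nu.

(** Each absent triangle at [vu] would on average contribute at least 1/8 to the quadratic form. The
    total deficit of the star values below 1/2 is at most [k5], which matters differently for many
    and for few absent triangles. *)
Lemma miss_tri_ge u : u != v ->
  miss u / 8%:R
  <= \sum_(w | (w != v) && (w != u)) (1 - wt v u w) * tri f v u w ^+ 2.
Proof.
move=> uv.
have w01 w : 0 <= 1 - wt v u w by rewrite subr_ge0 wt_le1.
(* With many absent triangles, [tri ^ 2 >= (f v w) ^ 2 >= 1 / 4 - (1 / 2 - f v w)], and the summed
   deficit [k5] is at most half of [miss u / 4]. *)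
have [big|small] := lerP (8%:R * k5) (miss u).
  apply: le_trans (_ : miss u / 4%:R - k5 <= _); first by lra.
  rewrite lerBlDr.
  apply: le_trans (_ : \sum_(w | (w != v) && (w != u))
    ((1 - wt v u w) * tri f v u w ^+ 2 + (1 / 2%:R - f v w)) <= _).
    rewrite /miss mulr_suml; apply: ler_sum => w _.
    have : f v w ^+ 2 <= tri f v u w ^+ 2.
      rewrite ler_pXn2r ?nnegrE ?tri_ge0 // /tri.
      by have := f_ge0 v u; have := f_ge0 u w; lra.
    have := sqr_ge0 (f v w - 1 / 2%:R); have := f_le_half v w.
    by move: (wt_cases R tau v u w) => [->|[-> _]]; lra.
  rewrite big_split /= lerD2l; apply: le_trans star_defect.
  rewrite [leLHS]big_mkcond; apply: ler_sum => w _.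
  by case: ifP => // _; rewrite subr_ge0 f_le_half.
(* With few absent triangles, [f v u] alone suffices, since [(3 / 8) ^ 2 > 1 / 8]. It is that large
   because the equation at [vu] sums almost all the star values; the constants in [n_big] are what a
   value below 3/8 would contradict. *)
suff x38 : 3%:R / 8%:R <= f v u.
  rewrite /miss mulr_suml; apply: ler_sum => w _; apply: ler_wpM2l => //.
  apply: le_trans (_ : (3%:R / 8%:R) ^+ 2 <= _); first by lra.
  rewrite ler_pXn2r ?nnegrE ?tri_ge0 //; last by lra.
  by rewrite /tri; have := f_ge0 v w; have := f_ge0 u w; lra.
rewrite leNgt; apply/negP => x38.
have E := missE uv.
have lower : deg v u / 2%:R - k5 <= \sum_w wt v u w * f v w.
  rewrite lerBlDr; apply: le_trans (_ : \sum_w (wt v u w * f v w + (1 / 2%:R - f v w)) <= _).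
    rewrite /edge_deg mulr_suml; apply: ler_sum => w _; have := f_le_half v w.
    by move: (wt_cases R tau v u w) => [->|[-> _]]; lra.
  by rewrite big_split /= lerD2l star_defect.
have upper : \sum_w wt v u w * f v w <= (q - deg v u) * f v u.
  rewrite mulrBl eig /edge_deg mulr_suml -sumrB; apply: ler_sum => w _.
  have := f_ge0 u w; rewrite /tri.
  by move: (wt_cases R tau v u w) => [->|[-> _]]; lra.
have : 0 <= (q - deg v u) * (3%:R / 8%:R - f v u).
  by apply: mulr_ge0; [have := deg_le_nu v u; move: q_ge n4 |]; lra.
by move: n_big q_le; lra.
Qed.

(** * Completing the star at [v] by exchanging triangles *)

Section Swap.
Variable tau' : 'I_n -> 'I_n -> 'I_n -> bool.
Local Notation wt' := (face_wt R tau').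
Hypothesis tau'_sym : sym3 false tau'.
Hypothesis tau'_star : forall u w, u != v -> w != v -> w != u -> tau' v u w.
Hypothesis swap_energy :
  \sum_x \sum_y \sum_z wt' x y z * tri f x y z ^+ 2
  <= \sum_x \sum_y \sum_z wt x y z * tri f x y z ^+ 2.
Hypothesis swap_count :
  \sum_(x | x != v) \sum_(y | y != v) \sum_(z | z != v)
     wt x y z * (1 - wt' x y z) <= 3%:R * missing.

Lemma wt_tri2_sym s : sym3 false s ->
  sym3 0 (fun x y z => face_wt R s x y z * tri f x y z ^+ 2).
Proof.
move=> s_sym; split=> [x y z|x y z|x y].
- by rewrite (wtC R s_sym) /tri (fC x y); congr (_ * _ ^+ 2); ring.
- by rewrite (wtCA R s_sym) /tri (fC y z); congr (_ * _ ^+ 2); ring.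
- by rewrite (wtxx R s_sym) mul0r.
Qed.

Hypothesis n_big' : 9%:R * k4 < nu.

(** [tau'] has every triangle at [v] and omits at most as many outer triangles of [tau] as [tau]
    misses at [v]. A gained triangle is worth at least 1/8 on average, a lost one at most
    [(3 * k4 / nu) ^ 2], so [swap_energy] can hold only if [missing] is 0. *)
Lemma star_complete u w : u != v -> w != v -> w != u -> tau v u w.
Proof.
have sE := sum_triples_split v (wt_tri2_sym tau_sym).
have sE' := sum_triples_split v (wt_tri2_sym tau'_sym).
move: swap_energy; rewrite sE sE' => energy.
have gain : missing / 8%:R <= \sum_x \sum_y wt' v x y * tri f v x y ^+ 2
                         - \sum_x \sum_y wt v x y * tri f v x y ^+ 2.
  rewrite missingE mulr_suml -sumrB.
  apply: le_trans (ler_sum _ (fun u uv => miss_tri_ge uv)) _.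
  rewrite big_mkcond; apply: ler_sum => x _; rewrite -sumrB.
  have [->|xv] := eqVneq x v.
    by apply: sumr_ge0 => y _; rewrite (wtxx R tau_sym) (wtxx R tau'_sym) subrr.
  rewrite /= big_mkcond; apply: ler_sum => y _.
  have [->|yv] := eqVneq y v.
    by rewrite (wtxyx R tau_sym) (wtxyx R tau'_sym) mul0r subrr.
  have [->|yx] := eqVneq y x.
    by rewrite (wtxyy R tau_sym) (wtxyy R tau'_sym) mul0r subrr.
  by rewrite /= -mulrBl {2}/face_wt tau'_star.
have k40 : 0 <= k4 by move: k_ge0; lra.
have n0 : 0 < nu by move: n4; lra.
have loss : nu ^+ 2 * (
    \sum_(x | x != v) \sum_(y | y != v) \sum_(z | z != v) wt x y z * tri f x y z ^+ 2
    - \sum_(x | x != v) \sum_(y | y != v) \sum_(z | z != v) wt' x y z * tri f x y z ^+ 2)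
   <= (3%:R * k4) ^+ 2 * (3%:R * missing).
  apply: le_trans (_ : (3%:R * k4) ^+ 2 *
    (\sum_(x | x != v) \sum_(y | y != v) \sum_(z | z != v)
     wt x y z * (1 - wt' x y z)) <= _); last by rewrite ler_wpM2l ?sqr_ge0.
  rewrite -sumrB !mulr_sumr; apply: ler_sum => x xv.
  rewrite -sumrB !mulr_sumr; apply: ler_sum => y yv.
  rewrite -sumrB !mulr_sumr; apply: ler_sum => z zv.
  have : (nu * tri f x y z) ^+ 2 <= (3%:R * k4) ^+ 2.
    have nt0 : 0 <= nu * tri f x y z by apply: mulr_ge0; [exact: ltW|exact: tri_ge0].
    have k0' : 0 <= 3%:R * k4 by lra.
    rewrite ler_pXn2r ?nnegrE //.
    rewrite /tri !mulrDr; have := f_off_le xv yv; have := f_off_le xv zv.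
    by have := f_off_le yv zv; lra.
  have := sqr_ge0 (nu * tri f x y z); rewrite exprMn.
  by move: (wt_cases R tau x y z) (wt_cases R tau' x y z)
    => [->|[-> _]] [->|[-> _]]; lra.
have miss_ge0 x : 0 <= miss x.
  by apply: sumr_ge0 => y _; rewrite subr_ge0 wt_le1.
have M0 : missing = 0.
  apply/eqP; rewrite eq_le; apply/andP; split; last first.
    by rewrite missingE; apply: sumr_ge0.
  rewrite leNgt; apply/negP => Mpos.
  have p1 : (9%:R * k4) ^+ 2 < nu ^+ 2 by rewrite ltr_pXn2r ?nnegrE //; move: n_big'; lra.
  have p2 : 0 < (nu ^+ 2 - (9%:R * k4) ^+ 2) * missing.
    by apply: mulr_gt0 => //; rewrite subr_gt0.
  have p3 : 0 <= nu ^+ 2 * (\sum_x \sum_y wt' v x y * tri f v x y ^+ 2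
      - \sum_x \sum_y wt v x y * tri f v x y ^+ 2 - missing / 8%:R).
    by rewrite mulr_ge0 ?sqr_ge0 // subr_ge0.
  have p4 := ler_wpM2l (sqr_ge0 nu) energy.
  have p5 : 0 <= k4 ^+ 2 * missing by rewrite mulr_ge0 ?sqr_ge0 // ltW.
  clear sE sE' energy gain.
  move: p2 p3 p4 p5 loss.
  set S1 := \sum_x \sum_y _; set S2 := \sum_x \sum_y _.
  set S3 := \sum_(x | _) _; set S4 := \sum_(x | _) _.
  move: Mpos; set m := missing; move: S1 S2 S3 S4 m => S1 S2 S3 S4 m *.
  lra.
move=> uv wv wu.
have mu : miss u = 0.
  apply/eqP; have /eqP := M0; rewrite missingE psumr_eq0 // => /allP/(_ u).
  by rewrite mem_index_enum uv => /(_ isT).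
have /eqP := mu; rewrite psumr_eq0; last by move=> y _; rewrite subr_ge0 wt_le1.
move=> /allP/(_ w); rewrite mem_index_enum wv wu => /(_ isT) /=.
by move: (wt_cases R tau v u w) => [->|[_ ->]] //; rewrite subr0 oner_eq0.
Qed.

End Swap.

(** * Radius estimates when the star at [v] is complete *)

Section Tent.
Hypothesis tau_star : forall u w, u != v -> w != v -> w != u -> tau v u w.

Let S := \sum_w f v w.
Let Y := \sum_(u | u != v) \sum_(w | w != v) f u w.
Let P := \sum_(x | x != v) \sum_(y | y != v) \sum_(z | z != v)
  wt x y z * tri f x y z.

Lemma deg_star u : u != v -> deg v u = nu - 2%:R.
Proof.
move=> uv; have := missE uv; rewrite /miss big1 => [|w /andP[wv wu]]; first by lra.
by rewrite /face_wt tau_star // subrr.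
Qed.

Lemma tent_eig_star : q * S = 2%:R * (nu - 2%:R) * S + Y.
Proof.
have -> : q * S = \sum_w \sum_z (wt v w z * f v w + wt v w z * f v z + wt v w z * f w z).
  rewrite /S mulr_sumr; apply: eq_bigr => w _; rewrite eig; apply: eq_bigr => z _.
  by rewrite /tri !mulrDr.
under eq_bigr do rewrite !big_split /=.
rewrite !big_split /=.
have e1 : \sum_w \sum_z wt v w z * f v w = (nu - 2%:R) * S.
  rewrite /S mulr_sumr; apply: eq_bigr => w _; rewrite -mulr_suml -/(deg v w).
  have [->|wv] := eqVneq w v; first by rewrite perron_diag !mulr0.
  by rewrite deg_star.
have e2 : \sum_w \sum_z wt v w z * f v z = (nu - 2%:R) * S.
  rewrite exchange_big /= -e1; apply: eq_bigr => w _; apply: eq_bigr => z _.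
  by rewrite (wtCA R tau_sym).
have e3 : \sum_w \sum_z wt v w z * f w z = Y.
  rewrite /Y [RHS]big_mkcond; apply: eq_bigr => w _.
  have [->|wv] := eqVneq w v.
    by rewrite big1 // => z _; rewrite (wtxx R tau_sym) mul0r.
  rewrite /= [RHS]big_mkcond; apply: eq_bigr => z _.
  have [->|zv] := eqVneq z v; first by rewrite (wtxyx R tau_sym) mul0r.
  have [->|zw] := eqVneq z w; first by rewrite perron_diag mulr0.
  by rewrite /face_wt tau_star // mul1r.
by rewrite e1 e2 e3; ring.
Qed.

(** The triangles [vuw], summed over [u] and [w], reproduce the equations at the edges [vu] and
    hence [q * S]. *)
Lemma tent_eig_base : q * Y = q * S + P.
Proof.
rewrite /Y mulr_sumr.
transitivity (\sum_(u | u != v) \sum_(w | w != v) (wt v u w * tri f v u w +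
   \sum_(z | z != v) wt u w z * tri f u w z)).
  apply: eq_bigr => u uv; rewrite mulr_sumr; apply: eq_bigr => w wv.
  rewrite eig (bigD1 v) //=; congr (_ + _).
  rewrite (wtCA R tau_sym) (wtC R tau_sym) /tri (fC v u) (fC v w); ring.
under eq_bigr do rewrite big_split /=.
rewrite big_split /=; congr (_ + _).
rewrite /S mulr_sumr big_mkcond; apply: eq_bigr => u _.
have [->|uv] := eqVneq u v; first by rewrite perron_diag mulr0.
rewrite /= eig sum_predC1 //.
by rewrite (wtxyx R tau_sym) mul0r.
Qed.

(** The factor [2 * (nu - 2) * S + Y] is the pairing, over ordered pairs, of [f] with the Perron
    vector of the tented complex: [nu - 2] on edges at [v] and 1 elsewhere. Its eigenvalue there is
    [2 * nu - 3], so only the extra triangles, collected in [P], remain. *)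
Lemma tent_eig_defect :
  (q - (2%:R * nu - 3%:R)) * (2%:R * (nu - 2%:R) * S + Y) = P.
Proof.
have h1 := tent_eig_star; have h2 := tent_eig_base.
transitivity (2%:R * (nu - 2%:R) * (q * S - (2%:R * (nu - 2%:R) * S + Y))
  + (q * Y - (2%:R * (nu - 2%:R) * S + Y))); first by ring.
by rewrite h2 h1; ring.
Qed.

(** Now [missing] is 0, so [off_sum <= 6 * t]: apart from [uwv], with triangle sum at most 1, only
    boundedly many triangles contribute, each [O(1 / nu)]. *)
Lemma f_off_sharp u w : u != v -> w != v ->
  q * f u w * nu <= nu + 18%:R * t%:R * k4.
Proof.
move=> uv wv; have off_le : off_sum <= 6%:R * t%:R.
  have := off_sum_le_missing; rewrite missingE big1 ?mulr0 ?add0r // => x xv.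
  by apply: big1 => y /andP[yv yx]; rewrite /face_wt tau_star // subrr.
rewrite eig (bigD1 v) //= mulrDl lerD //.
  rewrite -[leRHS]mul1r ler_wpM2r ?ler0n //.
  exact: le_trans (wt_tri_le tri_le1 _ _ _) (wt_le1 _ _ _ _ _).
rewrite mulr_suml.
apply: le_trans (_ : \sum_(z | z != v) wt u w z * (3%:R * k4) <= _).
  apply: ler_sum => z zv; rewrite -mulrA ler_wpM2l ?wt_ge0 //.
  rewrite mulrC /tri !mulrDr; have := f_off_le uv wv; have := f_off_le uv zv.
  by have := f_off_le wv zv; lra.
rewrite -mulr_suml.
have -> : 18%:R * t%:R * k4 = (6%:R * t%:R) * (3%:R * k4) by ring.
apply: ler_wpM2r; first by move: k_ge0; lra.
apply: le_trans off_le; apply: le_trans (off_sum_ge uv).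
rewrite [leRHS](bigD1 w) //= lerDl.
by do 2!(apply: sumr_ge0 => ? _); apply: wt_ge0.
Qed.

Lemma off_tri_le :
  P * (2%:R * nu - 3%:R) * nu <= 18%:R * t%:R * (nu + 18%:R * t%:R * k4).
Proof.
have off_le : off_sum <= 6%:R * t%:R.
  have := off_sum_le_missing; rewrite missingE big1 ?mulr0 ?add0r // => x xv.
  by apply: big1 => y /andP[yv yx]; rewrite /face_wt tau_star // subrr.
have k40 : 0 <= k4 by move: k_ge0; lra.
have B0 : 0 <= 3%:R * (nu + 18%:R * t%:R * k4).
  by rewrite mulr_ge0 ?addr_ge0 ?mulr_ge0 ?ler0n.
have -> : 18%:R * t%:R * (nu + 18%:R * t%:R * k4)
   = (6%:R * t%:R) * (3%:R * (nu + 18%:R * t%:R * k4)) by ring.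
apply: le_trans (ler_wpM2r B0 off_le).
rewrite -mulrA /P /off_sum !mulr_suml; apply: ler_sum => x xv.
rewrite !mulr_suml; apply: ler_sum => y yv.
rewrite !mulr_suml; apply: ler_sum => z zv.
rewrite -mulrA ler_wpM2l ?wt_ge0 //.
have h1 := f_off_sharp xv yv; have h2 := f_off_sharp xv zv.
have h3 := f_off_sharp yv zv.
have : 0 <= (q - (2%:R * nu - 3%:R)) * (tri f x y z * nu).
  by rewrite mulr_ge0 ?subr_ge0 // mulr_ge0 ?ler0n // tri_ge0.
rewrite /tri; lra.
Qed.

(** In the pairing of [tent_eig_defect] the nonnegative [Y] is dropped and [S] is replaced by its
    lower bound [nu / 2 - k5]. *)
Lemma tent_upper_raw :
  (q - (2%:R * nu - 3%:R)) * (nu - 2%:R) * (nu - 2%:R * k5)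
    * (2%:R * nu - 3%:R) * nu
  <= 18%:R * t%:R * (nu + 18%:R * t%:R * k4).
Proof.
apply: le_trans off_tri_le; rewrite -tent_eig_defect.
have Y0 : 0 <= Y by rewrite /Y; do 2!(apply: sumr_ge0 => ? _).
have n2 : 0 <= nu - 2%:R by move: n4; lra.
have h := star_sum_ge; rewrite -/S in h.
apply: ler_wpM2r; first by rewrite ler0n.
apply: ler_wpM2r; first by move: n4; lra.
rewrite -mulrA; apply: ler_wpM2l; first by rewrite subr_ge0.
have : 0 <= (nu - 2%:R) * (S - (nu / 2%:R - k5)) by apply: mulr_ge0; rewrite // subr_ge0.
lra.
Qed.

End Tent.
End NearTent.

(** * Rayleigh quotients *)

Lemma continuous_sum (T : topologicalType) (R : realType) (I : Type) (r : seq I)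
    (P : pred I) (F : I -> T -> R) :
  (forall i, P i -> continuous (F i)) ->
  continuous (fun x => \sum_(i <- r | P i) F i x).
Proof.
move=> cF x; apply: cvg_big => [|i Pi]; first exact: add_continuous.
exact: cF.
Qed.

Lemma continuous_sqr (T : topologicalType) (R : realType) (F : T -> R) :
  continuous F -> continuous (fun x => F x ^+ 2).
Proof. by move=> cF x; have := cvgM (cF x) (cF x); apply; exact: nbhs_filter. Qed.

Section UnitSphere.
Variables (R : realType) (m : nat).

Definition sqnorm (u : 'rV[R]_m) : R := \sum_i u 0 i ^+ 2.

Lemma continuous_sqnorm : continuous sqnorm.
Proof.
apply: continuous_sum => i _; apply: continuous_sqr; exact: coord_continuous.
Qed.

Lemma compact_unit_sphere : compact [set u : 'rV[R]_m | sqnorm u = 1]%classic.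
Proof.
have box := @rV_compact R m (fun=> `[(-1 : R), 1]%classic) (fun=> @segment_compact _ _ _).
apply: subclosed_compact box _.
  have -> : [set u : 'rV[R]_m | sqnorm u = 1]%classic = (sqnorm @^-1` [set 1])%classic by [].
  by apply: preimage_closed; [move=> u _; exact: continuous_sqnorm | exact: closed_eq].
move=> u /= u1 i; rewrite in_itv /= -ler_norml -(@expr_le1 _ 2) // real_normK ?num_real //.
by rewrite -u1 /sqnorm (bigD1 i) //= lerDl; apply: sumr_ge0 => j _; exact: sqr_ge0.
Qed.

Lemma max_on_unit_sphere (phi : 'rV[R]_m -> R) : (0 < m)%N -> continuous phi ->
  exists2 c, sqnorm c = 1 & forall u, sqnorm u = 1 -> phi u <= phi c.
Proof.
move=> m0 cphi.
have ne : ([set u : 'rV[R]_m | sqnorm u = 1] !=set0)%classic.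
  exists (delta_mx 0 (Ordinal m0)); rewrite /= /sqnorm (bigD1 (Ordinal m0)) //=.
  rewrite big1 => [|i iN0]; first by rewrite mxE !eqxx expr1n addr0.
  by rewrite mxE (negPf iN0) andbF expr0n.
have [|c] := @EVT_max_rV R m phi _ ne compact_unit_sphere.
  by apply: continuous_subspaceT.
rewrite inE => c1 cmax; exists c => // u u1; apply: cmax; by rewrite inE.
Qed.
End UnitSphere.

(** * The Perron vector as a maximizer of the Rayleigh quotient *)

Section Perron.
Variables (R : realType) (n : nat) (K : {set {set 'I_n}}).
Local Notation E := (edge K).
Local Notation V := {ffun E -> R^o}.
Implicit Types h k : V.

Definition energy h : R := \sum_(F in faces 2 K) bsum h F ^+ 2.
Definition dotE h k : R := \sum_G h G * k G.

Lemma dot_signless_up h k :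
  dotE h (signless_up k) = \sum_(F in faces 2 K) bsum h F * bsum k F.
Proof.
rewrite /dotE.
under eq_bigr do rewrite ffunE big_mkcondr /= mulr_sumr.
rewrite exchange_big /=; apply: eq_bigr => F _.
rewrite /bsum mulr_suml [RHS]big_mkcond /=; apply: eq_bigr => G _.
by case: ifP => _; rewrite ?mulr0.
Qed.

Lemma energyE h : energy h = dotE h (signless_up h).
Proof. by rewrite dot_signless_up; apply: eq_bigr => F _; rewrite expr2. Qed.

Definition ffun_of_row (u : 'rV[R]_#|{: E}|) : V := [ffun G => u 0 (enum_rank G)].
Definition row_of_ffun h : 'rV[R]_#|{: E}| := \row_i h (enum_val i).

Lemma row_of_ffunK : cancel row_of_ffun ffun_of_row.
Proof. by move=> h; apply/ffunP => G; rewrite ffunE mxE enum_rankK. Qed.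

Lemma sqnorm_dotE u : sqnorm u = dotE (ffun_of_row u) (ffun_of_row u).
Proof.
rewrite /sqnorm /dotE (reindex enum_rank) /=; last exact/onW_bij/enum_rank_bij.
by apply: eq_bigr => G _; rewrite ffunE expr2.
Qed.

Lemma continuous_energy : continuous (energy \o ffun_of_row).
Proof.
apply: continuous_sum => F _; apply: continuous_sqr.
apply: continuous_sum => G _.
have -> : (fun u => ffun_of_row u G) = (fun u => u 0 (enum_rank G)).
  by apply/funext => u; rewrite ffunE.
exact: coord_continuous.
Qed.

Lemma dotE_ge0 h : 0 <= dotE h h.
Proof. by apply: sumr_ge0 => G _; rewrite -expr2 sqr_ge0. Qed.

Lemma dotE_eq0 h : dotE h h = 0 -> h = 0.
Proof.
move=> /eqP; rewrite psumr_eq0 => [/allP h0|G _]; last by rewrite -expr2 sqr_ge0.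
apply/ffunP => G; have /(_ (mem_index_enum _)) := h0 G.
by rewrite /= mulf_eq0 orbb ffunE => /eqP.
Qed.

Lemma bsumZ a h F : bsum (a *: h) F = a * bsum h F.
Proof. by rewrite /bsum mulr_sumr; apply: eq_bigr => G _; rewrite ffunE. Qed.

Lemma dotEC h k : dotE h k = dotE k h.
Proof. by apply: eq_bigr => G _; rewrite mulrC. Qed.

Lemma dotEZ a h k : dotE h (a *: k) = a * dotE h k.
Proof. by rewrite /dotE mulr_sumr; apply: eq_bigr => G _; rewrite ffunE mulrCA. Qed.

Lemma dotED h k k' : dotE h (k + k') = dotE h k + dotE h k'.
Proof. by rewrite /dotE -big_split; apply: eq_bigr => G _; rewrite ffunE mulrDr. Qed.

Lemma energyZ a h : energy (a *: h) = a ^+ 2 * energy h.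
Proof. by rewrite /energy mulr_sumr; apply: eq_bigr => F _; rewrite bsumZ exprMn. Qed.

(** A nonzero linear term would dominate for small [e] of the sign of [A]; [e = A / (|B| + 1)] is
    small enough. *)
Lemma quadratic_no_linear (A B : R) : (forall e, e * A + e ^+ 2 * B <= 0) -> A = 0.
Proof.
move=> H; have B0 : 0 < `|B| + 1 by rewrite ltr_pwDr // normr_ge0.
have := H (A / (`|B| + 1)).
have -> : A / (`|B| + 1) * A + (A / (`|B| + 1)) ^+ 2 * B
  = (A / (`|B| + 1)) ^+ 2 * (`|B| + 1 + B) by field; rewrite gt_eqF.
rewrite pmulr_lle0; last by have := ler_norm (- B); rewrite normrN; lra.
move=> h; have /eqP : (A / (`|B| + 1)) ^+ 2 = 0 by apply/le_anti; rewrite h sqr_ge0.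
rewrite sqrf_eq0 mulf_eq0 invr_eq0 (gt_eqF B0) orbF; exact: eqP.
Qed.

Hypothesis K_edge : (0 < #|{: E}|)%N.

Lemma perron_exists : exists c : V,
  [/\ dotE c c = 1, forall G, 0 <= c G,
      forall h, energy h <= energy c * dotE h h
    & signless_up c = energy c *: c].
Proof.
have [u u1 umax] := max_on_unit_sphere K_edge continuous_energy.
pose c0 := ffun_of_row u.
have max0 h : energy h <= energy c0 * dotE h h.
  have [h0|hN0] := eqVneq (dotE h h) 0.
    rewrite h0 mulr0 (dotE_eq0 h0) /energy big1 // => F _.
    by rewrite /bsum big1 ?expr0n // => G _; rewrite ffunE.
  have hpos : 0 < dotE h h by rewrite lt_neqAle eq_sym hN0 dotE_ge0.
  pose s := Num.sqrt (dotE h h).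
  have s2 : s ^+ 2 = dotE h h by rewrite sqr_sqrtr ?ltW.
  have := umax (row_of_ffun (s^-1 *: h)).
  rewrite sqnorm_dotE row_of_ffunK dotEZ dotEC dotEZ mulrA -expr2 exprVn s2 mulVf //.
  move=> /(_ erefl); rewrite /= row_of_ffunK energyZ exprVn s2.
  by rewrite ler_pdivrMl // mulrC.
(* Absolute values keep the norm and, by the triangle inequality on each face, do not lower the
   energy; so the maximizer may be taken nonnegative. *)
pose c : V := [ffun G => `|c0 G|].
have c1 : dotE c c = 1.
  rewrite -u1 sqnorm_dotE; apply: eq_bigr => G _.
  by rewrite /c ffunE -normrM ger0_norm // -expr2 sqr_ge0.
have ec : energy c = energy c0.
  apply/le_anti; rewrite -[X in _ <= X](mulr1) -c1 max0 /=.
  apply: ler_sum => F _; rewrite -[leLHS]real_normK ?num_real //.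
  rewrite ler_pXn2r ?nnegrE //; last by apply: sumr_ge0 => G _; rewrite ffunE.
  apply: le_trans (ler_norm_sum _ _ _) _.
  by apply: ler_sum => G _; rewrite [leRHS]ffunE.
have cmax h : energy h <= energy c * dotE h h by rewrite ec.
exists c; split=> // [G|]; first by rewrite ffunE.
apply/eqP; rewrite -subr_eq0; apply/eqP; apply: dotE_eq0.
(* Perturbing [c] along the residual [w] has first-order effect [2 * dotE w w], which must vanish at
   a maximum. *)
move wE: (signless_up c - energy c *: c) => w.
have {}wE : signless_up c = w + energy c *: c by rewrite -wE subrK.
have : 2%:R * dotE w w = 0.
  apply: (@quadratic_no_linear _ (energy w - energy c * dotE w w)) => e.
  have := cmax (c + e *: w).
  have lin : signless_up (c + e *: w) = e *: signless_up w + signless_up c.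
    by rewrite addrC; exact: signless_up_is_linear.
  rewrite energyE lin.
  rewrite !(dotED, dotEZ) ![dotE (c + e *: w) _]dotEC !(dotED, dotEZ).
  have -> : dotE (signless_up c) w = dotE w w + energy c * dotE w c.
    by rewrite dotEC wE dotED dotEZ.
  have -> : dotE (signless_up w) c = dotE w w + energy c * dotE w c.
    rewrite dotEC dot_signless_up.
    transitivity (dotE w (signless_up c)).
      by rewrite dot_signless_up; apply: eq_bigr => F _; rewrite mulrC.
    by rewrite wE dotED dotEZ.
  rewrite [dotE (signless_up c) c]dotEC -energyE [dotE (signless_up w) w]dotEC -energyE.
  by rewrite c1 (dotEC c w); lra.
by move/eqP; rewrite mulf_eq0 pnatr_eq0 /= => /eqP.
Qed.

Lemma leigenvalue_signlessP (a : R) :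
  reflect (exists2 h : V, h != 0 & signless_up h = a *: h)
    (passmx.leigenvalue (linfun (@signless_up R n K)) a).
Proof.
apply: (iffP idP) => [|[h h0 hE]].
  rewrite /passmx.leigenvalue -vpick0 => h0.
  exists (vpick (passmx.leigenspace (linfun (@signless_up R n K)) a)) => //.
  have := memv_pick (passmx.leigenspace (linfun (@signless_up R n K)) a).
  rewrite {1}/passmx.leigenspace memv_ker add_lfunE opp_lfunE scale_lfunE id_lfunE lfunE /=.
  by rewrite subr_eq0 => /eqP.
apply/eqP => h1; move: h0; apply/negP; rewrite negbK -memv0 -h1.
rewrite /passmx.leigenspace memv_ker add_lfunE opp_lfunE scale_lfunE id_lfunE lfunE /=.
by rewrite hE subrr.
Qed.

(** The Rayleigh maximum is an eigenvalue and bounds all others, so the supremum defining the radius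
    is attained there. *)
Lemma signless_radius_perron : exists c : V,
  [/\ dotE c c = 1, forall G, 0 <= c G,
      forall h, energy h <= signless_radius R K * dotE h h
    & signless_up c = signless_radius R K *: c].
Proof.
have [c [c1 c0 cmax cE]] := perron_exists.
suff -> : signless_radius R K = energy c by exists c.
have ub a : passmx.leigenvalue (linfun (@signless_up R n K)) a -> a <= energy c.
  move=> /leigenvalue_signlessP[h h0 hE].
  have := cmax h; rewrite energyE hE dotEZ ler_pM2r //.
  rewrite lt_neqAle dotE_ge0 andbT eq_sym; apply: contra_neq h0; exact: dotE_eq0.
have mem : passmx.leigenvalue (linfun (@signless_up R n K)) (energy c).
  apply/leigenvalue_signlessP; exists c => //; apply: contra_eq_neq c1 => ->.
  by rewrite /dotE big1 1?eq_sym ?oner_eq0 // => G _; rewrite ffunE mulr0.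
apply/le_anti/andP; split.
  by apply: ge_sup => [|a /ub//]; exists (energy c).
by apply: ub_le_sup => //; exists (energy c) => a /ub.
Qed.

End Perron.

(** * Faces as ordered tuples *)

Section OrderedPairs.
Variables (R : realType) (n : nat).
Implicit Types (K : {set {set 'I_n}}) (F G : {set 'I_n}) (x y z : 'I_n).

(** Membership in [faces 2] fixes the cardinality at 3, so degenerate triples are excluded
    automatically. *)
Definition tau K x y z : bool := [set x; y; z]%SET \in faces 2 K.

Lemma card_set3 x y z :
  (#|[set x; y; z]%SET| == 3%N) = [&& x != y, x != z & y != z].
Proof.
rewrite finset.setUC cardsU1 cards2 !inE (eq_sym z x) (eq_sym z y).
by case: (x == y); case: (x == z); case: (y == z).
Qed.

Lemma faces2_tau K x y z : tau K x y z -> [&& x != y, x != z & y != z].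
Proof. by rewrite /tau inE -card_set3 => /andP[]. Qed.

Lemma tau_sym K : sym3 false (tau K).
Proof.
split=> [x y z|x y z|x y].
- by rewrite /tau (finset.setUC [set x]%SET).
- by rewrite /tau finset.setUAC.
- by apply/negP => /faces2_tau; rewrite eqxx.
Qed.

Lemma sum_subfaces F (psi : {set 'I_n} -> R) : #|F| = 3%N ->
  \sum_(G : {set 'I_n} | (#|G| == 2%N) && (G \subset F)) psi G = \sum_(w in F) psi (F :\ w)%SET.
Proof.
move=> F3.
have inj : {in F &, injective (fun w => F :\ w)%SET}.
  move=> u w uF wF /setP/(_ w); rewrite !inE eqxx wF andbT.
  by case: eqVneq.
rewrite -(big_imset _ inj) /=; apply: eq_bigl => G.
apply/andP/imsetP => [[/eqP G2 GF]|[w wF ->]].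
  have : #|F :\: G| == 1%N by rewrite cardsDS // F3 G2.
  move=> /cards1P[w wE]; exists w.
    have : w \in (F :\: G)%SET by rewrite wE set11.
    by rewrite inE => /andP[].
  by rewrite -wE finset.setDDr finset.setDv finset.set0U; apply/esym/finset.setIidPr.
split; last exact: subsetDl.
by have := cardsD1 w F; rewrite wF F3 add1n => -[<-].
Qed.

Lemma sum_set3 (psi : 'I_n -> R) x y z : [&& x != y, x != z & y != z] ->
  \sum_(w in [set x; y; z]%SET) psi w = psi x + psi y + psi z.
Proof.
case/and3P=> xy xz yz.
rewrite -finset.setUA big_setU1 ?inE ?negb_or ?xy //= big_setU1 ?inE //= big_set1.
by rewrite addrA.
Qed.

Lemma set3D1 x y z : [&& x != y, x != z & y != z] ->
  [/\ [set x; y; z] :\ x = [set y; z], [set x; y; z] :\ y = [set x; z]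
    & [set x; y; z] :\ z = [set x; y]]%SET.
Proof.
case/and3P=> xy xz yz; split; apply/setP => w; rewrite !inE.
- by have [->|wx] := eqVneq w x; rewrite ?(negPf xy) ?(negPf xz).
- by have [->|wx] := eqVneq w y; rewrite 1?eq_sym ?(negPf xy) ?(negPf yz) ?orbF.
- by have [->|wx] := eqVneq w z; rewrite ?orbF // !(eq_sym z) (negPf xz) (negPf yz).
Qed.

Lemma sum_cofaces K x y (psi : {set 'I_n} -> R) : x != y ->
  \sum_(F in faces 2 K | [set x; y]%SET \subset F) psi F
  = \sum_z face_wt R (tau K) x y z * psi [set x; y; z]%SET.
Proof.
move=> xy.
transitivity (\sum_(z in [set z | tau K x y z]%SET) psi [set x; y; z]%SET); last first.
  rewrite big_mkcond; apply: eq_bigr => z _; rewrite inE /face_wt.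
  by case: tau; rewrite ?mul1r ?mul0r.
have inj : {in [set z | tau K x y z]%SET &, injective (fun z => [set x; y; z]%SET)}.
  move=> z w; rewrite !inE => /faces2_tau/and3P[_ xz yz] _ /setP/(_ z).
  by rewrite !inE eqxx !orbT !(eq_sym z) (negPf xz) (negPf yz) => /esym/eqP.
rewrite -(big_imset _ inj) /=; apply: eq_bigl => F.
apply/andP/imsetP => [[FK xyF]|[z]]; last first.
  by rewrite inE => t ->; split=> //; apply: finset.subsetUl.
have F3 : #|F| = 3%N by move: FK; rewrite inE => /andP[_ /eqP].
have : #|F :\: [set x; y]| == 1%N by rewrite cardsDS // F3 cards2 xy.
move=> /cards1P[z zE].
have FE : F = [set x; y; z]%SET.
  by rewrite -zE -[LHS](finset.setID F [set x; y]%SET) (finset.setIidPr xyF).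
by exists z => //; rewrite inE /tau -FE.
Qed.

Lemma sum_edges (S : {set {set 'I_n}}) (psi : {set 'I_n} -> R) :
  (forall G, G \in S -> #|G| = 2%N) ->
  \sum_x \sum_y ((x != y) && ([set x; y]%SET \in S))%:R * psi [set x; y]%SET
  = 2%:R * \sum_(G in S) psi G.
Proof.
move=> S2.
transitivity (\sum_(G in S) \sum_x \sum_y ((x != y) && ([set x; y]%SET == G))%:R * psi G).
  rewrite [RHS]exchange_big /=; apply: eq_bigr => x _.
  rewrite [RHS]exchange_big /=; apply: eq_bigr => y _.
  have [xyS|xyS] := boolP ([set x; y]%SET \in S).
    rewrite (bigD1 [set x; y]%SET) //= eqxx big1 ?addr0 // => G /andP[_ /negPf nG].
    by rewrite [_ == G]eq_sym nG andbF mul0r.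
  rewrite andbF mul0r big1 // => G GS.
  by case: ([set x; y]%SET =P G) => [e|_]; [rewrite e GS in xyS|rewrite andbF mul0r].
rewrite mulr_sumr; apply: eq_bigr => G /S2/eqP/cards2P[a [b [ab ->]]].
have pairE x y : (x != y) && ([set x; y]%SET == [set a; b]%SET) =
    ((x == a) && (y == b)) || ((x == b) && (y == a)).
  apply/idP/idP => [/andP[xy /eqP e]|/orP[] /andP[/eqP-> /eqP->]].
  - have xab : x \in [set a; b]%SET by rewrite -e !inE eqxx.
    have yab : y \in [set a; b]%SET by rewrite -e !inE eqxx orbT.
    move: xab yab xy; rewrite !inE => /orP[] /eqP-> /orP[] /eqP->;
    by rewrite !eqxx ?orbT.
  - by rewrite ab eqxx.
  - by rewrite eq_sym ab finset.setUC eqxx.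
have delta (w : 'I_n) (r : R) : \sum_x (x == w)%:R * r = r.
  by rewrite -mulr_suml (bigD1 w) //= eqxx big1 ?addr0 ?mul1r // => x /negPf->.
set p := psi _.
transitivity (\sum_x \sum_y
    ((x == a)%:R * ((y == b)%:R * p) + (x == b)%:R * ((y == a)%:R * p))).
  apply: eq_bigr => x _; apply: eq_bigr => y _; rewrite pairE.
  have [->|xa] := eqVneq x a; first by rewrite (negPf ab) /= orbF !mul0r addr0 mul1r.
  by case: (x == b); case: (y == a); rewrite /= ?(mul0r, add0r, mul1r).
under eq_bigr do rewrite big_split /= -!mulr_sumr !delta.
by rewrite big_split /= !delta; ring.
Qed.

End OrderedPairs.

Section PairForms.
Variables (R : realType) (n : nat).
Implicit Types (K : {set {set 'I_n}}) (F G : {set 'I_n}) (x y z : 'I_n).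

(** One factor of the square is split over the three edges of the triangle, and each part is summed
    by the eigenvalue equation. *)
Lemma tau_energy (s : 'I_n -> 'I_n -> 'I_n -> bool) (f : 'I_n -> 'I_n -> R) (q : R) :
  sym3 false s -> (forall x y, f x y = f y x) ->
  (forall x y, q * f x y = \sum_z face_wt R s x y z * tri f x y z) ->
  \sum_x \sum_y \sum_z face_wt R s x y z * tri f x y z ^+ 2
  = 3%:R * q * \sum_x \sum_y f x y ^+ 2.
Proof.
move=> s_sym fC eig.
have E1 : \sum_x \sum_y \sum_z face_wt R s x y z * tri f x y z * f x y
    = q * \sum_x \sum_y f x y ^+ 2.
  rewrite mulr_sumr; apply: eq_bigr => x _; rewrite mulr_sumr.
  by apply: eq_bigr => y _; rewrite -mulr_suml -eig expr2 mulrA.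
have E2 : \sum_x \sum_y \sum_z face_wt R s x y z * tri f x y z * f x z
    = q * \sum_x \sum_y f x y ^+ 2.
  rewrite -E1; apply: eq_bigr => x _; rewrite exchange_big /=.
  apply: eq_bigr => y _; apply: eq_bigr => z _.
  by rewrite (wtCA R s_sym) /tri (fC y z); congr (_ * _ * _); ring.
have E3 : \sum_x \sum_y \sum_z face_wt R s x y z * tri f x y z * f y z
    = q * \sum_x \sum_y f x y ^+ 2.
  rewrite -E2 exchange_big /=; apply: eq_bigr => x _; apply: eq_bigr => y _.
  apply: eq_bigr => z _.
  by rewrite (wtC R s_sym) /tri (fC x y); congr (_ * _ * _); ring.
transitivity (\sum_x \sum_y \sum_z (face_wt R s x y z * tri f x y z * f x y +
   face_wt R s x y z * tri f x y z * f x z + face_wt R s x y z * tri f x y z * f y z)).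
  apply: eq_bigr => x _; apply: eq_bigr => y _; apply: eq_bigr => z _.
  by rewrite -!mulrDr -/(tri f x y z) expr2 mulrA.
under eq_bigr do under eq_bigr do rewrite !big_split /=.
under eq_bigr do rewrite !big_split /=.
by rewrite !big_split /= E1 E2 E3; ring.
Qed.

Lemma sum_faces2 K (Phi : {set 'I_n} -> R) :
  \sum_x \sum_y \sum_z face_wt R (tau K) x y z * Phi [set x; y; z]%SET
  = 6%:R * \sum_(F in faces 2 K) Phi F.
Proof.
pose S := [set G : {set 'I_n} | #|G| == 2%N]%SET.
transitivity (\sum_x \sum_y ((x != y) && ([set x; y]%SET \in S))%:R *
   \sum_(F in faces 2 K | [set x; y]%SET \subset F) Phi F).
  apply: eq_bigr => x _; apply: eq_bigr => y _; rewrite inE cards2.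
  have [->|xy] := eqVneq x y; last by rewrite sum_cofaces // mul1r.
  by rewrite mul0r big1 // => z _; rewrite (wtxx R (tau_sym K)) mul0r.
rewrite (sum_edges (fun G => \sum_(F in faces 2 K | G \subset F) Phi F)); last first.
  by move=> G; rewrite inE => /eqP.
have -> : 6%:R = 2%:R * 3%:R :> R by rewrite -natrM.
rewrite -mulrA; congr (_ * _).
under eq_bigr do rewrite big_mkcondr.
rewrite exchange_big /= mulr_sumr; apply: eq_bigr => F; rewrite inE => /andP[_ /eqP F3].
rewrite -big_mkcondr /= (eq_bigl (fun G : {set 'I_n} => (#|G| == 2%N) && (G \subset F))); last first.
  by move=> G; rewrite inE.
by rewrite (sum_subfaces _ F3) sumr_const F3 mulr_natl.
Qed.

Variable K : {set {set 'I_n}}.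
Hypothesis hK : simplicial_complex K.

Lemma subface F G : F \in K -> G \subset F -> G \in K.
Proof. by move=> FK GF; move/forall_inP/(_ F FK)/forallP/(_ G)/implyP: hK; apply. Qed.

Lemma tau_edge x y z : tau K x y z -> [set x; y]%SET \in faces 1 K.
Proof.
move=> t; have /and3P[xy _ _] := faces2_tau t; move: t; rewrite /tau !inE cards2 xy.
by move=> /andP[FK _]; rewrite (subface FK) // finset.subsetUl.
Qed.

Lemma bsum_subfaces (c : {ffun edge K -> R^o}) (C : {set 'I_n} -> R) F :
  (forall G : edge K, C (val G) = c G) -> F \in faces 2 K ->
  bsum c F = \sum_(w in F) C (F :\ w)%SET.
Proof.
move=> cC; rewrite inE => /andP[FK /eqP F3]; rewrite -(sum_subfaces _ F3) /bsum.
rewrite (eq_bigr (fun G : edge K => C (val G))) => [|G _]; last by rewrite cC.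
rewrite -(big_sub_cond (faces 1 K) (fun G => G \subset F) C).
apply: eq_bigl => G; rewrite inE; case: (boolP (G \subset F)) => GF; rewrite ?andbF //.
by rewrite (subface FK).
Qed.

Lemma bsum_tri (c : {ffun edge K -> R^o}) (C : {set 'I_n} -> R) f x y z :
  (forall G : edge K, C (val G) = c G) ->
  (forall x y, x != y -> C [set x; y]%SET = f x y) -> tau K x y z ->
  bsum c [set x; y; z]%SET = tri f x y z.
Proof.
move=> cC Cf t; have xyz := faces2_tau t; have /and3P[xy xz yz] := xyz.
rewrite (bsum_subfaces cC) // sum_set3 //; have [-> -> ->] := set3D1 xyz.
by rewrite !Cf // /tri; ring.
Qed.

Hypothesis K_edge : (0 < #|{: edge K}|)%N.

Lemma perron_pairs : exists f : 'I_n -> 'I_n -> R,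
  [/\ forall x y, f x y = f y x, forall x y, 0 <= f x y,
      exists x y, 0 < f x y
    & forall x y, signless_radius R K * f x y
        = \sum_z face_wt R (tau K) x y z * tri f x y z].
Proof.
have [c [c1 c0 _ cE]] := signless_radius_perron R K_edge.
(* Pairs that are not edges of [K], including [x x], get value 0. This respects the eigenvalue
   equation because no triangle of [K] contains such a pair. *)
pose C (G : {set 'I_n}) : R := if insub G is Some e then c e else 0.
have cC (G : edge K) : C (val G) = c G by rewrite /C valK.
have C0 G : 0 <= C G by rewrite /C; case: (insub _) => // e; exact: c0.
exists (fun x y => C [set x; y]%SET); split=> // [x y||x y].
- by rewrite finset.setUC.
- have [G cG] : exists G : edge K, 0 < c G.
    apply/existsP; apply: contraPT c1 => /existsPn cN.
    rewrite /dotE big1 => [/eqP|G _]; first by rewrite eq_sym oner_eq0.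
    have cG0 : c G = 0 by apply/le_anti; rewrite c0 leNgt cN.
    by rewrite cG0 mulr0.
  have : #|val G| == 2%N by have := valP G; rewrite inE => /andP[].
  by move=> /cards2P[x [y [_ e]]]; exists x, y; rewrite -e cC.
have [xyK|xyK] := boolP ([set x; y]%SET \in faces 1 K); last first.
  rewrite {1}/C insubN // mulr0 big1 // => z _.
  by rewrite /face_wt; case: (boolP (tau K x y z)) => [/tau_edge|_]; rewrite ?(negPf xyK) ?mul0r.
have xy : x != y by apply: contraTneq xyK => ->; rewrite inE cards2 eqxx andbF.
pose G : edge K := exist (fun G : {set 'I_n} => G \in faces 1 K) _ xyK.
have /ffunP/(_ G) := cE; rewrite !ffunE => /esym.
have -> : c G = C [set x; y]%SET by rewrite -cC.
rewrite sum_cofaces //.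
move=> e; transitivity (signless_radius R K *: (C [set x; y]%SET : R^o)) => //.
rewrite e; apply: eq_bigr => z _; rewrite /face_wt.
case: (boolP (tau K x y z)) => [t|_]; last by rewrite !mul0r.
by rewrite (bsum_tri (f := fun x y => C [set x; y]%SET) cC).
Qed.

(** [f] may live on edges outside [K]: these only enlarge the right-hand side. This allows testing
    one complex with the Perron vector of another. *)
Lemma rayleigh_pairs (f : 'I_n -> 'I_n -> R) :
  (forall x y, f x y = f y x) -> (forall x, f x x = 0) ->
  \sum_x \sum_y \sum_z face_wt R (tau K) x y z * tri f x y z ^+ 2
  <= 3%:R * signless_radius R K * \sum_x \sum_y f x y ^+ 2.
Proof.
move=> fC f0; have [c [c1 _ cmax cE]] := signless_radius_perron R K_edge.
have r0 : 0 <= signless_radius R K.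
  rewrite -[X in 0 <= X]mulr1 -c1 -dotEZ -cE -energyE.
  by apply: sumr_ge0 => F _; exact: sqr_ge0.
(* A function of the unordered edge that returns [f x y]: both orders are summed, the diagonal terms
   are 0, and the result is halved. *)
pose C (G : {set 'I_n}) : R := (\sum_(x in G) \sum_(y in G) f x y) / 2%:R.
have Cf x y : x != y -> C [set x; y]%SET = f x y.
  move=> xy; rewrite /C !big_setU1 ?inE //= !big_set1 !big_setU1 ?inE //= !big_set1.
  by rewrite !f0 (fC y x); field.
pose h : {ffun edge K -> R^o} := [ffun G => C (val G)].
have hC (G : edge K) : C (val G) = h G by rewrite ffunE.
have -> : \sum_x \sum_y \sum_z face_wt R (tau K) x y z * tri f x y z ^+ 2 = 6%:R * energy h.
  rewrite /energy -sum_faces2; apply: eq_bigr => x _; apply: eq_bigr => y _.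
  apply: eq_bigr => z _; rewrite /face_wt.
  case: (boolP (tau K x y z)) => [t|_]; last by rewrite !mul0r.
  by rewrite (bsum_tri hC Cf).
have h2 : 2%:R * dotE h h <= \sum_x \sum_y f x y ^+ 2.
  have -> : dotE h h = \sum_(G in faces 1 K) C G ^+ 2.
    rewrite (big_sub (faces 1 K) (fun G => C G ^+ 2)) /dotE.
    by apply: eq_bigr => G _; rewrite -expr2 -hC.
  rewrite -(sum_edges (fun G => C G ^+ 2)); last by move=> G; rewrite inE => /andP[_ /eqP].
  apply: ler_sum => x _; apply: ler_sum => y _.
  case: eqVneq => [->|xy] /=; first by rewrite mul0r sqr_ge0.
  by rewrite Cf //; case: (_ \in _); rewrite ?mul1r ?mul0r ?sqr_ge0.
have := cmax h; have := ler_wpM2l r0 h2; lra.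
Qed.

End PairForms.

(** * Homology *)

Section Boundary.
Variables (R : realType) (n : nat).
Implicit Types (K : {set {set 'I_n}}) (F G H X : {set 'I_n}) (u v w x : 'I_n).
Local Notation inc := (@incidence R n).

Definition face_sign X v : R := (-1) ^+ #|[set u in X | (u < v)%N]%SET|.

Lemma face_sign_neq0 X v : face_sign X v != 0.
Proof. by rewrite /face_sign signr_eq0. Qed.

Lemma setD1_inj X : {in X &, injective (fun w => X :\ w)%SET}.
Proof.
by move=> u w uX wX /setP/(_ w); rewrite !inE eqxx wX andbT; case: eqVneq.
Qed.

Lemma incidenceD1 X v : v \in X -> inc X (X :\ v)%SET = face_sign X v.
Proof.
move=> vX; rewrite /incidence (bigD1 v) ?vX ?eqxx //= big1 ?addr0 // => u.
case/andP=> /andP[uX /eqP e] /negP[]; apply/eqP.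
by apply: (setD1_inj uX vX); rewrite e.
Qed.

Lemma incidence_neq0 X G : inc X G != 0 -> exists2 v, v \in X & G = (X :\ v)%SET.
Proof.
move=> h; have : [exists v in X, G == X :\ v]%SET.
  apply: contraNT h => /existsPn h; rewrite /incidence big1 // => v /andP[vX e].
  by have := h v; rewrite vX e.
by case/exists_inP=> v vX /eqP; exists v.
Qed.

Lemma sum_incidence X (psi : {set 'I_n} -> R) :
  \sum_G inc X G * psi G = \sum_(v in X) face_sign X v * psi (X :\ v)%SET.
Proof.
transitivity (\sum_G \sum_(v in X) (G == X :\ v)%SET%:R * (face_sign X v * psi G)).
  apply: eq_bigr => G _; rewrite /incidence mulr_suml big_mkcondr.
  by apply: eq_bigr => v _; case: eqP => _; rewrite ?mul1r ?mul0r.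
rewrite exchange_big /=; apply: eq_bigr => v vX.
rewrite (bigD1 (X :\ v)%SET) //= eqxx mul1r big1 ?addr0 // => G /negPf->.
by rewrite mul0r.
Qed.

Lemma face_signD1 X u v : v \in X -> u != v ->
  face_sign (X :\ v) u = (-1) ^+ (v < u)%N * face_sign X u.
Proof.
move=> vX uv; rewrite /face_sign -exprD.
have [vu|uv'] := ltnP v u.
  rewrite (cardsD1 v [set w in X | (w < u)%N]%SET) !inE vX vu /=.
  have -> : ([set w in X :\ v | (w < u)%N] = [set w in X | (w < u)%N] :\ v)%SET.
    by apply/setP => w; rewrite !inE andbA.
  by rewrite !add1n !exprS !mulN1r opprK.
rewrite add0n; congr (_ ^+ #|pred_of_set _|); apply/setP => w; rewrite !inE.
by have [->|//] := eqVneq w v; rewrite ltnNge uv' !andbF.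
Qed.

(** Deleting [v] then [u] and deleting [u] then [v] give the same set with opposite signs. *)
Lemma boundary_boundary X H : \sum_G inc X G * inc G H = 0.
Proof.
rewrite sum_incidence.
pose A v u : R := ((u != v) && (H == X :\ v :\ u)%SET)%:R
   * (face_sign X v * face_sign X u * (-1) ^+ (v < u)%N).
have -> : \sum_(v in X) face_sign X v * inc (X :\ v)%SET H = \sum_(v in X) \sum_(u in X) A v u.
  apply: eq_bigr => v vX; rewrite /incidence mulr_sumr.
  rewrite (eq_bigl (fun u => (u \in X) && ((u != v) && (H == X :\ v :\ u)%SET))) => [|u]; last first.
    by rewrite in_setD1 andbA [(u \in X) && _]andbC.
  rewrite big_mkcondr; apply: eq_bigr => u uX; rewrite /A.
  case: eqVneq => [//|uv] /=; first by rewrite mul0r.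
  case: eqP => _; rewrite ?mul0r ?mul1r //.
  by rewrite -/(face_sign (X :\ v)%SET u) face_signD1 // mulrCA mulrC.
have anti v u : A v u = - A u v.
  rewrite /A eq_sym; case: eqVneq => [|uv] /=; first by rewrite !mul0r oppr0.
  have -> : (X :\ v :\ u = X :\ u :\ v)%SET by rewrite !finset.setDDl finset.setUC.
  case: eqP => _; rewrite ?mul0r ?oppr0 // !mul1r mulrC.
  rewrite [face_sign X v * _]mulrC -mulrN mulrC; congr (_ * _).
  have [_|_|/ord_inj e] := ltngtP v u; last by rewrite e eqxx in uv.
    by rewrite expr1 expr0.
  by rewrite expr1 expr0 opprK.
have : \sum_(v in X) \sum_(u in X) A v u = - \sum_(v in X) \sum_(u in X) A v u.
  rewrite {1}exchange_big -sumrN; apply: eq_bigr => v _.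
  by rewrite -sumrN; apply: eq_bigr => u _; rewrite anti.
by lra.
Qed.

End Boundary.

Section RankBounds.
Variable F : fieldType.

Lemma rank_ge_diagonal m p (M : 'M[F]_(m, p)) (I : finType) (r : I -> 'I_m)
    (c : I -> 'I_p) :
  (forall i, M (r i) (c i) != 0) -> (forall i j, i != j -> M (r i) (c j) = 0) ->
  (#|I| <= \rank M)%N.
Proof.
move=> Mii Mij.
pose P : 'M[F]_(#|I|, m) := \matrix_(i, k) (k == r (enum_val i))%:R.
pose Q : 'M[F]_(p, #|I|) := \matrix_(k, j) (k == c (enum_val j))%:R.
have PM i l : (P *m M) i l = M (r (enum_val i)) l.
  rewrite mxE (bigD1 (r (enum_val i))) //= !mxE eqxx mul1r big1 ?addr0 // => k kr.
  by rewrite !mxE (negPf kr) mul0r.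
have E i j : (P *m M *m Q) i j = M (r (enum_val i)) (c (enum_val j)).
  rewrite mxE (bigD1 (c (enum_val j))) //= PM mxE eqxx mulr1 big1 ?addr0 // => k kc.
  by rewrite [Q _ _]mxE (negPf kc) mulr0.
have PMQ : P *m M *m Q = diag_mx (\row_i M (r (enum_val i)) (c (enum_val i))).
  apply/matrixP => i j; rewrite E !mxE; case: eqVneq => [->|ij]; first by rewrite mulr1n.
  by rewrite mulr0n Mij // (inj_eq enum_val_inj).
have : \rank (P *m M *m Q) = #|I|.
  apply: mxrank_unit; rewrite PMQ unitmxE det_diag unitfE.
  by apply/prodf_neq0 => i _; rewrite mxE.
by move=> <-; apply: leq_trans (mxrankM_maxl _ _) (mxrankM_maxr _ _).
Qed.

End RankBounds.

(** * Bounds on the second Betti number *)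

Section Betti.
Variables (R : realType) (n : nat).
Implicit Types (K : {set {set 'I_n}}) (F G H X : {set 'I_n}) (u v w x : 'I_n).
Local Notation inc := (@incidence R n).

Lemma row_boundary K k (u : 'rV[R]_#|faces k K|) (z : {set 'I_n} -> R) j :
  (forall i, u 0 i = z (enum_val i)) ->
  (u *m boundary_mx R K k) 0 j = \sum_(F in faces k K) z F * inc F (enum_val j).
Proof.
move=> uz; rewrite mxE [RHS]big_enum_val; apply: eq_bigr => i _.
by rewrite uz mxE.
Qed.

(** Each cycle [z i] has a private face [e i] in its support, so the matrix of cycles contains an
    invertible diagonal block. *)
Lemma independent_cycles K k (I : finType) (z : I -> {set 'I_n} -> R) (e : I -> {set 'I_n}) :
  (forall i, e i \in faces k K) ->
  (forall i G, G \in faces k.-1 K -> \sum_(F in faces k K) z i F * inc F G = 0) ->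
  (forall i, z i (e i) != 0) -> (forall i j, i != j -> z i (e j) = 0) ->
  (#|I| <= \rank (kermx (boundary_mx R K k)))%N.
Proof.
move=> eK zcycle zii zij.
pose U : 'M[R]_(#|I|, #|faces k K|) := \matrix_(i, j) z (enum_val i) (enum_val j).
have U0 : (U <= kermx (boundary_mx R K k))%MS.
  apply/row_subP => i; apply/sub_kermxP/rowP => j.
  rewrite (row_boundary (z := z (enum_val i))); last by move=> l; rewrite !mxE.
  by rewrite [RHS]mxE; apply: zcycle; exact: enum_valP.
apply: leq_trans (mxrankS U0).
apply: (@rank_ge_diagonal _ _ _ U I (fun i => enum_rank i)
  (fun i => enum_rank_in (eK i) (e i))) => [i|i j ij];
  rewrite mxE enum_rankK enum_rankK_in ?eK //; exact: zij.
Qed.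

Lemma pure_face_sub K G d : pure d K -> G \in K ->
  exists2 F, F \in faces d K & G \subset F.
Proof.
move=> pK GK; pose P F := (F \in K).
have [F maxF GF] := @maxset_exists _ P G GK; exists F => //.
have /fintype.subsetP sub : facets K \subset faces d K := pK.
apply: sub; have FK : F \in K := maxsetp maxF.
rewrite inE FK /=; apply/forall_inP => H HK; apply/implyP => FH.
by rewrite (maxsetsup maxF HK FH).
Qed.

(** Purity leaves no 3-faces, hence no 2-boundaries to divide out. *)
Lemma betti2_pure K : pure 2 K ->
  betti R K 2 = (#|faces 2 K| - \rank (boundary_mx R K 2))%N.
Proof.
move=> pK; rewrite /betti mxrank_ker.
have f3 : #|faces 3 K| = 0%N.
  apply/eqP; rewrite cards_eq0; apply/eqP/setP => F; rewrite !inE.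
  apply/negP => /andP[FK /eqP F4]; have [G] := pure_face_sub pK FK.
  by rewrite inE => /andP[_ /eqP G3] /subset_leq_card; rewrite F4 G3.
have -> : \rank (boundary_mx R K 3) = 0%N.
  by apply/eqP; rewrite -leqn0 -[X in (_ <= X)%N]f3 rank_leq_row.
by rewrite subn0.
Qed.

(** A 1-cycle vanishing on all edges off [v] is zero, so keeping only the columns of those edges
    does not enlarge the kernel of the boundary map. *)
Lemma rank_boundary2_le K v : simplicial_complex K ->
  (\rank (boundary_mx R K 2) <= #|[set G in faces 1 K | v \notin G]%SET|)%N.
Proof.
move=> hK; set S := [set G in faces 1 K | v \notin G]%SET.
pose M : 'M[R]_(#|faces 2 K|, #|S|) := \matrix_(i, j) inc (enum_val i) (enum_val j).
apply: leq_trans (rank_leq_col M).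
suff h : (kermx M <= kermx (boundary_mx R K 2))%MS.
  have := mxrankS h; rewrite !mxrank_ker.
  have := rank_leq_row M; have := rank_leq_row (boundary_mx R K 2).
  by move=> h1 h2; rewrite leq_sub2lE.
apply/rV_subP => u /sub_kermxP uM; apply/sub_kermxP.
pose z (F : {set 'I_n}) : R := \sum_(i | enum_val i == F) u 0 i.
have uz i : u 0 i = z (enum_val i).
  by rewrite /z (eq_bigl (pred1 i)) ?big_pred1_eq // => j; rewrite (inj_eq enum_val_inj).
pose b G := \sum_(F in faces 2 K) z F * inc F G.
have b0 G : G \in S -> b G = 0.
  move=> GS; have /matrixP/(_ 0 (enum_rank_in GS G)) := uM; rewrite !mxE => <-.
  rewrite /b big_enum_val; apply: eq_bigr => i _.
  by rewrite mxE uz enum_rankK_in.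
apply/rowP => j; rewrite (row_boundary j uz) [RHS]mxE -/(b _).
have := enum_valP j; move: (enum_val j) => G GK.
have [vG|vG] := boolP (v \in G); last by apply: b0; rewrite inE GK.
(* The boundary of the 1-cycle [b] is evaluated at the endpoint of [G] other than [v]. Every other
   edge there avoids [v], so [b G] is the only surviving term. *)
have bb : \sum_G' b G' * inc G' (G :\ v)%SET = 0.
  rewrite /b; under eq_bigr do rewrite mulr_suml.
  rewrite exchange_big /= big1 // => F _.
  rewrite (eq_bigr (fun G' => z F * (inc F G' * inc G' (G :\ v)%SET))).
    by rewrite -mulr_sumr boundary_boundary mulr0.
  by move=> G' _; rewrite mulrA.
move: bb; rewrite (bigD1 G) //= big1 ?addr0 => [|G' G'G].
  by move/eqP; rewrite mulf_eq0 incidenceD1 // (negPf (face_sign_neq0 _ _ _)) orbF => /eqP.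
have G2 : #|G| = 2%N by move: GK; rewrite inE => /andP[_ /eqP].
have [->|bN0] := eqVneq (b G') 0; first by rewrite mul0r.
have [->|incN0] := eqVneq (inc G' (G :\ v)%SET) 0; first by rewrite mulr0.
have [y yG' e] := incidence_neq0 incN0.
have G'2 : #|G'| = 2%N.
  by rewrite (cardsD1 y) yG' -e; have := cardsD1 v G; rewrite vG G2 => <-.
have G'K : G' \in faces 1 K.
  apply: contraNT bN0 => G'K; rewrite /b big1 // => F.
  rewrite inE => /andP[FK _].
  have [->|/incidence_neq0[w wF eG']] := eqVneq (inc F G') 0; first by rewrite mulr0.
  by case/negP: G'K; rewrite inE G'2 eqxx andbT (subface hK FK) // eG' subsetDl.
have vG' : v \in G'.
  by apply: contraNT bN0 => vG'; apply/eqP/b0; rewrite inE G'K.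
case/negP: G'G; apply/eqP.
have [yv|yv] := eqVneq y v.
  by rewrite -[LHS](finset.setD1K vG') -[RHS](finset.setD1K vG) e yv.
by have := set11 v; have := in_setD1 v G v; rewrite e !inE eq_sym yv vG' eqxx.
Qed.

Lemma card_edges_off_le v (S : {set {set 'I_n}}) :
  (forall G, G \in S -> #|G| = 2%N /\ v \notin G) -> (#|S| <= 'C(n.-1, 2))%N.
Proof.
move=> hS; have cv : #|[set~ v]%SET| = n.-1 by rewrite cardsC1 card_ord.
rewrite -cv -cards_draws; apply: subset_leq_card; apply/fintype.subsetP => G /hS[G2 vG].
rewrite inE G2 eqxx andbT; apply/fintype.subsetP => x xG.
by rewrite !inE; apply: contraNneq vG => <-.
Qed.

Lemma card_faces2_le K t v : complexes2 R t K -> (#|faces 2 K| <= 'C(n.-1, 2) + t)%N.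
Proof.
move=> [hK _ pK]; rewrite betti2_pure // => <-.
rewrite addnC -leq_subLR subKn ?rank_leq_row //.
apply: leq_trans (rank_boundary2_le v hK) _; apply: (@card_edges_off_le v).
move=> G; rewrite inE => /andP[]; rewrite inE => /andP[_ /eqP G2] vG.
by split.
Qed.

(** For each such [w] the boundary of the tetrahedron [abcw] is a 2-cycle of [K], and the face [abw]
    occurs in no other of these cycles. *)
Lemma card_tetrahedra_le K t a b c : complexes2 R t K -> tau K a b c ->
  (#|[set w | [&& tau K a b w, tau K a c w & tau K b c w]]%SET| <= t)%N.
Proof.
move=> [hK _ pK <-] tabc; rewrite betti2_pure // -mxrank_ker.
set W := [set w | _]%SET.
pose X w := (w |: [set a; b; c])%SET.
have WP w : w \in W ->
    [/\ tau K a b w, tau K a c w, tau K b c w & w \notin [set a; b; c]%SET].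
  rewrite inE => /and3P[abw acw bcw]; split=> //.
  rewrite !inE !negb_or !(eq_sym w).
  by have /and3P[_ -> ->] := faces2_tau abw; have /and3P[_ _ ->] := faces2_tau acw.
have abc := faces2_tau tabc; have [e1 e2 e3] := set3D1 abc.
have facesX w u : w \in W -> u \in X w -> (X w :\ u)%SET \in faces 2 K.
  move=> /WP[abw acw bcw wN]; rewrite /X in_setU1 => /orP[/eqP->|].
    by rewrite setU1K.
  move=> u3; have uw : u != w by apply: contraNneq wN => <-.
  have -> : ((w |: [set a; b; c]) :\ u = w |: ([set a; b; c] :\ u))%SET.
    rewrite finset.setDUl; congr (_ :|: _)%SET; apply/finset.setDidPl.
    by rewrite disjoints1 inE eq_sym.
  have : [|| u == a, u == b | u == c] by move: u3; rewrite !inE orbA.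
  by case/or3P=> /eqP->; rewrite ?e1 ?e2 ?e3 finset.setUC.
pose z (w : {w | w \in W}) F := inc (X (val w)) F.
pose e (w : {w | w \in W}) := [set a; b; val w]%SET.
have eX w : w \in W -> [set a; b; w]%SET = (X w :\ c)%SET.
  move=> /WP[_ acw _ wN]; have /and3P[_ _ cw] := faces2_tau acw.
  rewrite /X finset.setDUl e3 finset.setUC; congr (_ :|: _)%SET.
  by apply/esym/finset.setDidPl; rewrite disjoints1 inE eq_sym.
have cX w : c \in X w by rewrite !inE eqxx !orbT.
have -> : #|W| = #|{: {w | w \in W}}| by rewrite card_sig; apply: eq_card.
apply: (independent_cycles (z := z) (e := e)) => [w|w G GK|w|w w' ww'].
- by have := valP w => /WP[].
- rewrite -[RHS](boundary_boundary R (X (val w)) G) big_mkcond /=.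
  apply: eq_bigr => F _; case: ifP => // /negbT FK.
  rewrite /z; have [->|/incidence_neq0[u uX eF]] := eqVneq (inc (X (val w)) F) 0.
    by rewrite mul0r.
  by case/negP: FK; rewrite eF; apply: facesX => //; exact: valP.
- by rewrite /z /e (eX _ (valP w)) incidenceD1 // face_sign_neq0.
rewrite /z; apply/eqP; apply: contraNT ww' => /incidence_neq0[u uX eF].
have : val w' \in e w' by rewrite !inE eqxx !orbT.
rewrite eF !inE => /andP[_ /orP[/eqP h|]]; first by apply/eqP/val_inj.
have /WP[_ _ _] := valP w'; by rewrite !inE => /negPf->.
Qed.

End Betti.

(** * Tented complexes *)

Section TentedPlus.
Variables (R : realType) (n : nat) (v : 'I_n) (A : {set {set 'I_n}}).
Implicit Types (F G H : {set 'I_n}).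
Hypothesis n_ge3 : (3 <= n)%N.
Hypothesis A_off : forall F, F \in A -> #|F| = 3%N /\ v \notin F.

Local Notation K := (Defs.generated (tented v :|: A)%SET).

Lemma generated_tentedP G :
  reflect (exists2 F, F \in (tented_facets v :|: A)%SET & G \subset F) (G \in K).
Proof.
rewrite inE; apply: (iffP existsP) => [[F /andP[]]|[F]]; rewrite inE.
  case/orP=> [|FA GF]; last by exists F => //; rewrite inE FA orbT.
  rewrite inE => /existsP[F' /andP[F'T FF']] GF.
  by exists F'; [rewrite inE F'T | exact: fintype.subset_trans FF'].
move=> /orP[FT|FA] GF; exists F; rewrite GF inE ?FA ?orbT //= andbT.
by apply/orP; left; rewrite inE; apply/existsP; exists F; rewrite FT /=.
Qed.

Lemma card_tented_facet F : F \in (tented_facets v :|: A)%SET -> #|F| = 3%N.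
Proof. by rewrite !inE => /orP[/andP[/eqP]|/A_off[]]. Qed.

Lemma faces2_generated : faces 2 K = (tented_facets v :|: A)%SET.
Proof.
apply/setP => F; rewrite inE; apply/andP/idP => [[/generated_tentedP[F' F'T FF'] /eqP F3]|FT].
  suff -> : F = F' by [].
  by apply/eqP; rewrite eqEcard FF' F3 (card_tented_facet F'T).
split; last by rewrite (card_tented_facet FT).
by apply/generated_tentedP; exists F.
Qed.

Lemma generated_simplicial : simplicial_complex K.
Proof.
apply/forall_inP => F /generated_tentedP[F' F'T FF']; apply/forallP => G.
apply/implyP => GF; apply/generated_tentedP; exists F' => //.
exact: fintype.subset_trans FF'.
Qed.

Lemma generated_pure : pure 2 K.
Proof.
apply/fintype.subsetP => F; rewrite faces2_generated inE => /andP[FK maxF].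
have /generated_tentedP[F' F'T FF'] := FK.
have F'K : F' \in K by apply/generated_tentedP; exists F'.
by move/forall_inP/(_ _ F'K)/implyP/(_ FF')/eqP: maxF => <-.
Qed.

Lemma tented_star u w : u != v -> w != v -> w != u -> tau K v u w.
Proof.
move=> uv wv wu; rewrite /tau faces2_generated 2!inE card_set3 !inE eqxx.
by rewrite !(eq_sym v) uv wv eq_sym wu.
Qed.

Lemma generated_all_vertices : all_vertices K.
Proof.
have key u w : u != v -> w != v -> w != u ->
    forall x, x \in [set v; u; w]%SET -> [set x]%SET \in K.
  move=> uv wv wu x xF; apply/generated_tentedP; exists [set v; u; w]%SET.
    by have := tented_star uv wv wu; rewrite /tau faces2_generated.
  by rewrite finset.sub1set.
apply/forallP => x.
have [u [uv xu]] : exists u, u != v /\ x \in [set v; u]%SET.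
  have [->|xv] := eqVneq x v; last by exists x; rewrite !inE eqxx orbT.
  have : (0 < #|[set~ v]%SET|)%N by rewrite cardsC1 card_ord -subn1 subn_gt0 (ltn_trans _ n_ge3).
  by move=> /card_gt0P[u]; rewrite !inE => uv; exists u; rewrite !inE eqxx.
have : (0 < #|~: [set v; u]%SET|)%N.
  by rewrite cardsCs finset.setCK cards2 card_ord eq_sym uv subn_gt0.
move=> /card_gt0P[w]; rewrite finset.in_setC finset.in_set2 negb_or => /andP[wv wu].
by apply: (key u w uv wv wu); rewrite inE xu.
Qed.

Lemma card_tented_facets : #|tented_facets v| = 'C(n.-1, 2).
Proof.
have cv : #|[set~ v]%SET| = n.-1 by rewrite cardsC1 card_ord.
rewrite -cv -cards_draws.
have inj : {in [set G : {set 'I_n} | G \subset [set~ v]%SET & #|G| == 2%N]%SET &,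
    injective (fun G => v |: G)%SET}.
  move=> G H; rewrite !inE => /andP[Gv _] /andP[Hv _] e.
  have vN (X : {set 'I_n}) : X \subset [set~ v]%SET -> v \notin X.
    by move=> h; apply/negP => /(fintype.subsetP h); rewrite !inE eqxx.
  by rewrite -(finset.setU1K (vN _ Gv)) -(finset.setU1K (vN _ Hv)) e.
rewrite -(card_in_imset inj); apply: eq_card => F.
apply/idP/imsetP => [|[G]]; rewrite !inE.
  move=> /andP[F3 vF]; exists (F :\ v)%SET; last by rewrite finset.setD1K.
  have := cardsD1 v F; rewrite vF (eqP F3) add1n inE => -[<-]; rewrite eqxx andbT.
  by apply/fintype.subsetP => x; rewrite !inE => /andP[].
move=> /andP[Gv /eqP G2] ->; rewrite cardsU1 !inE eqxx G2 andbT.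
have -> // : v \notin G.
by apply/negP => /(fintype.subsetP Gv); rewrite !inE eqxx.
Qed.

Lemma tented_facets_disjoint : [disjoint tented_facets v & A].
Proof.
rewrite disjoint_subset; apply/fintype.subsetP => F; rewrite !inE => /andP[_ vF].
by apply/negP => /A_off[_]; rewrite vF.
Qed.

(** Rows [v |: G] against columns [G], for pairs [G] avoiding [v], form a diagonal block of signs;
    it reaches the upper bound of [rank_boundary2_le]. *)
Lemma rank_boundary2_generated : \rank (boundary_mx R K 2) = 'C(n.-1, 2).
Proof.
apply/eqP; rewrite eqn_leq; apply/andP; split.
  apply: leq_trans (rank_boundary2_le R v generated_simplicial) _.
  apply: (@card_edges_off_le _ v) => G; rewrite inE => /andP[]; rewrite inE.
  by move=> /andP[_ /eqP].
have cv : #|[set~ v]%SET| = n.-1 by rewrite cardsC1 card_ord.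
rewrite -cv -cards_draws.
set S := [set G : {set 'I_n} | (G \subset [set~ v]%SET) && (#|G| == 2%N)]%SET.
have SP (G : {G | G \in S}) : v \notin val G /\ #|val G| = 2%N.
  have := valP G; rewrite inE => /andP[Gv /eqP G2]; split=> //.
  by apply/negP => /(fintype.subsetP Gv); rewrite !inE eqxx.
have rK (G : {G | G \in S}) : (v |: val G)%SET \in faces 2 K.
  have [vG G2] := SP G.
  by rewrite faces2_generated !inE cardsU1 vG G2 eqxx.
have cK (G : {G | G \in S}) : val G \in faces 1 K.
  have [vG G2] := SP G; rewrite inE G2 eqxx andbT.
  have := rK G; rewrite inE => /andP[h _].
  by apply: (subface generated_simplicial h); exact: finset.subsetUr.
have -> : #|S| = #|{: {G | G \in S}}| by rewrite card_sig; apply: eq_card.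
pose I : finType := {G : {set 'I_n} | G \in S}.
pose r (G : I) := enum_rank_in (rK G) (v |: val G)%SET.
pose c (G : I) := enum_rank_in (cK G) (val G).
apply: (rank_ge_diagonal (r := r) (c := c)) => [G|G G' GG'];
  rewrite mxE !enum_rankK_in ?rK ?cK //.
  have [vG _] := SP G.
  by rewrite -{2}(finset.setU1K vG) incidenceD1 ?face_sign_neq0 // setU11.
apply/eqP; apply: contraNT GG' => /incidence_neq0[u uX e].
have [vG' _] := SP G'; have [vG _] := SP G.
have uv : u = v.
  by apply/eqP; move: vG'; rewrite e !inE eqxx /= andbT negbK eq_sym.
by apply/eqP/val_inj; rewrite e uv finset.setU1K.
Qed.

Lemma complexes2_generated : complexes2 R #|A| K.
Proof.
split; [exact: generated_simplicial|exact: generated_all_vertices|exact: generated_pure|].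
rewrite (betti2_pure R generated_pure) rank_boundary2_generated faces2_generated.
by rewrite cardsU (disjoint_setI0 tented_facets_disjoint) cards0 subn0 card_tented_facets addKn.
Qed.

End TentedPlus.

(** * Complexes with a complete star are tented *)

Section StarComplex.
Variables (R : realType) (n t : nat) (v : 'I_n) (K : {set {set 'I_n}}).
Hypothesis n_ge3 : (3 <= n)%N.
Hypothesis K2 : complexes2 R t K.
Hypothesis K_star : forall u w, u != v -> w != v -> w != u -> tau K v u w.

Definition off_faces := [set F in faces 2 K | v \notin F]%SET.

Lemma off_facesP F : F \in off_faces -> #|F| = 3%N /\ v \notin F.
Proof. by rewrite inE => /andP[]; rewrite inE => /andP[_ /eqP]. Qed.

Lemma star_complex_generated : K = Defs.generated (tented v :|: off_faces)%SET.
Proof.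
have [hK _ pK _] := K2.
have TK F : F \in (tented_facets v :|: off_faces)%SET -> F \in K.
  rewrite 2!inE => /orP[/andP[/eqP F3 vF]|]; last by rewrite !inE => /andP[/andP[]].
  have : #|F :\ v| == 2%N by have := cardsD1 v F; rewrite vF F3 add1n => -[<-].
  move=> /cards2P[u [w [uw e]]].
  have FE : F = [set v; u; w]%SET by rewrite -finset.setUA -e finset.setD1K.
  have : u \in (F :\ v)%SET by rewrite e !inE eqxx.
  have : w \in (F :\ v)%SET by rewrite e !inE eqxx orbT.
  rewrite !inE => /andP[wv _] /andP[uv _].
  have wu : w != u by rewrite eq_sym.
  by have := K_star uv wv wu; rewrite /tau -FE inE => /andP[].
apply/setP => G; apply/idP/generated_tentedP => [GK|[F /TK FK GF]]; last first.
  exact: (subface hK FK GF).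
have [F FK GF] := pure_face_sub pK GK; exists F => //.
move: (FK); rewrite !inE => /andP[-> ->] /=.
by case: (v \in F).
Qed.

(** The Betti number of a tented complex with added triangles is the number added, and that of [K]
    is [t]. *)
Lemma card_off_faces : #|off_faces| = t.
Proof.
have [_ _ _ <-] := complexes2_generated R n_ge3 off_facesP.
by rewrite -star_complex_generated; case: K2.
Qed.

Lemma star_complex_tented_plus : tented_plus v t K.
Proof.
exists off_faces; split; [exact: card_off_faces| |exact: star_complex_generated].
move=> F /off_facesP[F3 vF]; split=> //; apply: contraNN vF.
rewrite inE => /existsP[F' /andP[]]; rewrite inE => /andP[/eqP F'3 vF'] FF'.
suff -> : F = F' by [].
by apply/eqP; rewrite eqEcard FF' F3 F'3.
Qed.

End StarComplex.

Lemma isomorphic_refl n (K : {set {set 'I_n}}) : isomorphic K K.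
Proof.
exists 1%g; rewrite /relabel -[LHS]imset_id; apply: eq_imset => F /=.
by rewrite -[LHS]imset_id; apply: eq_imset => x; rewrite perm1.
Qed.

(** * Maximizers *)

Section Maximizers.
Variables (R : realType) (n t : nat).
Implicit Types (K : {set {set 'I_n}}) (F G : {set 'I_n}) (v x y z : 'I_n).
Local Notation nu := (n%:R : R).

Lemma bin2_natr : (2 <= n)%N -> 2%:R * ('C(n.-1, 2))%:R = (nu - 1) * (nu - 2%:R).
Proof.
case: n => [|[|m]] // _ /=.
have -> : 2%:R * ('C(m.+1, 2))%:R = (m.+1 * m)%:R :> R.
  by rewrite -natrM mul2n bin2 /= -[RHS](congr1 _ (odd_double_half _)) oddM /= andNb add0n.
by rewrite natrM -!natr1; ring.
Qed.

Lemma sum_wt_faces2 K :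
  \sum_x \sum_y \sum_z face_wt R (tau K) x y z = 6%:R * #|faces 2 K|%:R.
Proof.
have := sum_faces2 K (fun _ => 1 : R); rewrite sumr_const => <-.
by do 3!(apply: eq_bigr => ? _); rewrite mulr1.
Qed.

Lemma sum_wt_off K v (Phi : {set 'I_n} -> R) :
  \sum_(x | x != v) \sum_(y | y != v) \sum_(z | z != v)
     face_wt R (tau K) x y z * Phi [set x; y; z]%SET
  = 6%:R * \sum_(F in off_faces v K) Phi F.
Proof.
have -> : \sum_(F in off_faces v K) Phi F =
    \sum_(F in faces 2 K) (v \notin F)%:R * Phi F.
  rewrite (eq_bigl (fun F => (F \in faces 2 K) && (v \notin F))) => [|F]; last by rewrite inE.
  rewrite big_mkcondr; apply: eq_bigr => F _.
  by case: (v \in F); rewrite ?mul0r ?mul1r.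
rewrite -sum_faces2 big_mkcond; apply: eq_bigr => x _.
case: ifPn => [xv|]; last first.
  rewrite negbK => /eqP->; rewrite big1 // => y _; rewrite big1 // => z _.
  by rewrite !inE eqxx /= mul0r mulr0.
rewrite big_mkcond; apply: eq_bigr => y _.
case: ifPn => [yv|]; last first.
  rewrite negbK => /eqP->; rewrite big1 // => z _.
  by rewrite !inE eqxx !orbT /= mul0r mulr0.
rewrite big_mkcond; apply: eq_bigr => z _.
case: ifPn => [zv|]; last first.
  by rewrite negbK => /eqP->; rewrite !inE eqxx !orbT /= mul0r mulr0.
by rewrite !inE !negb_or !(eq_sym v) xv yv zv mul1r.
Qed.

Lemma off_sum_card K v : off_sum R (tau K) v = 6%:R * #|off_faces v K|%:R.
Proof.
have := sum_wt_off K v (fun _ => 1 : R); rewrite sumr_const => <-.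
by do 3!(apply: eq_bigr => ? _); rewrite mulr1.
Qed.

Lemma sum_wt_le K v : (2 <= n)%N -> complexes2 R t K ->
  \sum_x \sum_y \sum_z face_wt R (tau K) x y z
  <= 3%:R * (nu - 1) * (nu - 2%:R) + 6%:R * t%:R.
Proof.
move=> n2 /card_faces2_le - /(_ v) h.
rewrite sum_wt_faces2 -mulrA -bin2_natr //.
have : #|faces 2 K|%:R <= ('C(n.-1, 2) + t)%:R :> R by rewrite ler_nat.
by rewrite natrD; lra.
Qed.

Lemma edge_of_tau K x y z : simplicial_complex K -> tau K x y z ->
  (0 < #|{: edge K}|)%N.
Proof.
move=> hK /(tau_edge hK) h.
by apply/card_gt0P; exists (exist (fun G : {set 'I_n} => G \in faces 1 K) _ h).
Qed.

Lemma complexes2_edge K : (0 < t)%N -> complexes2 R t K -> (0 < #|{: edge K}|)%N.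
Proof.
move=> t0 [hK _ pK]; rewrite betti2_pure // => bt.
have : (0 < #|faces 2 K|)%N by apply: leq_trans t0 _; rewrite -bt leq_subr.
move=> /card_gt0P[F FK].
have : #|F| == 3%N by move: FK; rewrite inE => /andP[].
have [x xF] : exists x, x \in F.
  by apply/card_gt0P; move: FK; rewrite inE => /andP[_ /eqP->].
rewrite (cardsD1 x) xF add1n eqSS => /cards2P[y [z [yz e]]].
apply: (edge_of_tau (x := x) (y := y) (z := z) hK).
by rewrite /tau -finset.setUA -e finset.setD1K.
Qed.

Lemma exists_card_subset (B : {set {set 'I_n}}) m : (m <= #|B|)%N ->
  exists A : {set {set 'I_n}}, A \subset B /\ #|A| = m.
Proof.
move=> /card_geqP[s [us <- sB]]; exists [set x in s]%SET; split.
  by apply/fintype.subsetP => x; rewrite inE => /sB.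
by rewrite cardsE; exact/card_uniqP.
Qed.

(** Here [n - 1 >= t + 3], and ['C(m + 3, 3)] grows by at least 1 whenever [m] does. *)
Lemma card_off_triples v : (t + 4 <= n)%N ->
  (t <= #|[set F : {set 'I_n} | (F \subset [set~ v]%SET) && (#|F| == 3%N)]%SET|)%N.
Proof.
move=> tn; rewrite cards_draws cardsC1 card_ord.
have h m : (m <= 'C(m + 3, 3))%N.
  elim: m => // m IH; rewrite addSn binS.
  by rewrite -addn1 leq_add // bin_gt0 addn3.
apply: leq_trans (h t) _; apply: leq_bin2l.
by rewrite -ltnS prednK ?(leq_trans _ tn) ?addn4 // addn3.
Qed.

(** Supplies the extra triangles of a tented competitor. Nesting [A] with [E] makes the number of
    triangles lost in the exchange as small as possible. *)
Lemma exchange_triples v (E : {set {set 'I_n}}) : (t + 4 <= n)%N ->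
  (forall F, F \in E -> #|F| = 3%N /\ v \notin F) ->
  exists A : {set {set 'I_n}},
    [/\ #|A| = t, forall F, F \in A -> #|F| = 3%N /\ v \notin F
      & (A \subset E) || (E \subset A)].
Proof.
move=> tn hE; have [tE|Et] := leqP t #|E|.
  have [A [AE At]] := exists_card_subset tE.
  exists A; split=> // [F FA|]; last by rewrite AE.
  exact/hE/(fintype.subsetP AE).
set B := [set F : {set 'I_n} | (F \subset [set~ v]%SET) && (#|F| == 3%N)]%SET.
have EB : E \subset B.
  apply/fintype.subsetP => F /hE[F3 vF]; rewrite inE F3 eqxx andbT.
  by apply/fintype.subsetP => x xF; rewrite !inE; apply: contraNneq vF => <-.
have : (t - #|E| <= #|B :\: E|)%N.
  by rewrite cardsDS // leq_sub2r // card_off_triples.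
move=> /exists_card_subset[A [ABE At]].
have dis : [disjoint E & A].
  rewrite disjoint_sym; apply: disjointWl ABE _.
  by rewrite finset.disjoints_subset finset.setDE finset.subsetIr.
exists (E :|: A)%SET; split; last by rewrite finset.subsetUl orbT.
  by rewrite cardsU (disjoint_setI0 dis) cards0 subn0 At subnKC // ltnW.
move=> F; rewrite inE => /orP[/hE//|/(fintype.subsetP ABE)].
rewrite !inE => /andP[_ /andP[FV /eqP->]]; split=> //.
by apply/negP => /(fintype.subsetP FV); rewrite !inE eqxx.
Qed.

(** * A lower bound for the radius from a trial vector *)

Section TentedRayleigh.
Variables (v : 'I_n) (A : {set {set 'I_n}}).
Hypothesis n_ge4 : (4 <= n)%N.
Hypothesis A_off : forall F, F \in A -> #|F| = 3%N /\ v \notin F.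
Hypothesis A_card : #|A| = t.
Hypothesis t_gt0 : (0 < t)%N.
Local Notation K := (Defs.generated (tented v :|: A)%SET).

(* The Perron vector of the tented complex, whose radius is 2n - 3. *)
Let f x y : R :=
  if x == y then 0 else if (x == v) || (y == v) then nu - 2%:R else 1.

Lemma wt_tented u w : face_wt R (tau K) v u w = [&& u != v, w != v & w != u]%:R.
Proof.
rewrite /face_wt; case: (boolP [&& u != v, w != v & w != u]) => [/and3P[uv wv wu]|h].
  by rewrite tented_star.
case: (boolP (tau K v u w)) => // /faces2_tau/and3P[h1 h2 h3]; case/negP: h.
by rewrite !(eq_sym _ v) h1 h2 eq_sym.
Qed.

Let n2 : (2 <= n)%N. Proof. exact: leq_trans n_ge4. Qed.
Let n3 : (3 <= n)%N. Proof. exact: leq_trans n_ge4. Qed.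

Lemma ldeg_tented : link_size R (tau K) v = (nu - 1) * (nu - 2%:R).
Proof.
rewrite /link_size /edge_deg (bigD1 v) //= big1 ?add0r; last by move=> w _; rewrite wt_tented eqxx.
rewrite (eq_bigr (fun=> nu - 2%:R)) => [|u uv].
  have := sum_const_ord n (nu - 2%:R); rewrite (bigD1 v) //=; lra.
rewrite -(sum_off_const R uv) [RHS]big_mkcond; apply: eq_bigr => w _.
by rewrite wt_tented uv /=; case: (_ && _).
Qed.

Lemma off_sum_tented : off_sum R (tau K) v = 6%:R * t%:R.
Proof.
rewrite off_sum_card; congr (_ * _%:R); rewrite -A_card; apply: eq_card => F.
rewrite inE faces2_generated // !inE; case: (boolP (F \in A)) => [/A_off[-> ->]|_].
  by rewrite orbT.
by rewrite orbF -andbA andbN andbF.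
Qed.

Lemma sqnorm_tent : \sum_x \sum_y f x y ^+ 2 = (nu - 1) * (nu - 2%:R) * (2%:R * nu - 3%:R).
Proof.
have c1 (r : R) : \sum_(x | x != v) r = (nu - 1) * r.
  by have := sum_const_ord n r; rewrite (bigD1 v) //=; lra.
rewrite (bigD1 v) //=.
have -> : \sum_y f v y ^+ 2 = (nu - 1) * (nu - 2%:R) ^+ 2.
  rewrite (bigD1 v) //= /f eqxx expr0n add0r -c1; apply: eq_bigr => y yv.
  by rewrite eq_sym (negPf yv).
rewrite (eq_bigr (fun=> (nu - 2%:R) ^+ 2 + (nu - 2%:R))) => [|x xv].
  by rewrite c1; ring.
rewrite (bigD1 v) //= {1}/f (negPf xv) eqxx /= (bigD1 x) //= {1}/f eqxx expr0n add0r.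
congr (_ + _); rewrite -(sum_off_const R xv); apply: eq_bigr => y /andP[yv yx].
by rewrite /f eq_sym (negPf yx) (negPf xv) (negPf yv) expr1n.
Qed.

(** Triangles at [v] have trial sum [2 * nu - 3]. Each of the [t] others has trial sum 3 and six
    orderings, which gives [54 * t]. *)
Lemma energy_tent : \sum_x \sum_y \sum_z face_wt R (tau K) x y z * tri f x y z ^+ 2
  = 3%:R * (2%:R * nu - 3%:R) ^+ 2 * ((nu - 1) * (nu - 2%:R)) + 54%:R * t%:R.
Proof.
have fC x y : f x y = f y x by rewrite /f eq_sym orbC.
rewrite (sum_triples_split v (wt_tri2_sym fC (tau_sym K))).
congr (_ + _).
  rewrite -mulrA; congr (_ * _); rewrite -ldeg_tented /link_size mulr_sumr.
  apply: eq_bigr => x _; rewrite /edge_deg mulr_sumr; apply: eq_bigr => y _.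
  rewrite wt_tented; case: (boolP [&& _, _ & _]) => [/and3P[xv yv yx]|_]; 
  last by rewrite mul0r mulr0.
  rewrite mul1r mulr1 /tri /f !(eq_sym v) (eq_sym x y) (negPf xv) (negPf yv) (negPf yx) eqxx /=.
  by congr (_ ^+ 2); ring.
have -> : 54%:R * t%:R = 9%:R * off_sum R (tau K) v by rewrite off_sum_tented; ring.
rewrite /off_sum !mulr_sumr; apply: eq_bigr => x xv; rewrite !mulr_sumr.
apply: eq_bigr => y yv; rewrite !mulr_sumr; apply: eq_bigr => z zv.
rewrite /face_wt; case: (boolP (tau K x y z)) => [/faces2_tau/and3P[xy xz yz]|_]; 
  last by rewrite mul0r mulr0.
rewrite /tri /f (negPf xy) (negPf xz) (negPf yz) (negPf xv) (negPf yv) (negPf zv) /=.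
ring.
Qed.

Lemma tented_radius_ge :
  18%:R * t%:R <= (signless_radius R K - (2%:R * nu - 3%:R))
     * ((nu - 1) * (nu - 2%:R) * (2%:R * nu - 3%:R)).
Proof.
have K2 : complexes2 R t K by rewrite -A_card; exact: complexes2_generated.
have fC x y : f x y = f y x by rewrite /f eq_sym orbC.
have fxx x : f x x = 0 by rewrite /f eqxx.
have := rayleigh_pairs (generated_simplicial v A) (complexes2_edge t_gt0 K2) fC fxx.
rewrite energy_tent sqnorm_tent; lra.
Qed.

End TentedRayleigh.

(** The maximizer beats some tented complex with [t] added triangles; [(nu - 1) * (nu - 2) * (2 * nu
    - 3) <= 2 * nu ^ 3] then turns [18 * t] into [9 * t]. *)
Lemma maximizer_radius_ge K : (t + 4 <= n)%N -> (0 < t)%N -> maximizer R t K ->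
  9%:R * t%:R <= (signless_radius R K - (2%:R * nu - 3%:R)) * nu ^+ 3.
Proof.
move=> tn t0 [K2 Kmax].
have n4 : (4 <= n)%N by apply: leq_trans tn; rewrite leq_addl.
have n0 : (0 < n)%N by exact: leq_trans n4.
pose v := Ordinal n0.
have [|A [At A_off _]] := @exchange_triples v finset.set0 tn.
  by move=> F; rewrite inE.
have L2 : complexes2 R t (Defs.generated (tented v :|: A)%SET).
  by rewrite -At; apply: complexes2_generated => //; exact: leq_trans n4.
have le := Kmax _ L2.
have h := tented_radius_ge n4 A_off At t0.
move: le h; set r := signless_radius R K; set r' := signless_radius R _.
move: r r' => r r' le h.
have nu4 : 4%:R <= nu by rewrite ler_nat.
have t1 : 0 <= t%:R :> R by rewrite ler0n.
have p0 : 0 < (nu - 1) * (nu - 2%:R) * (2%:R * nu - 3%:R).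
  by rewrite !mulr_gt0 //; lra.
have d0 : 0 <= r' - (2%:R * nu - 3%:R).
  by rewrite -(pmulr_lge0 _ p0); lra.
have p1 : (nu - 1) * (nu - 2%:R) * (2%:R * nu - 3%:R) <= 2%:R * nu ^+ 3.
  have q1 : 0 <= nu * (nu - 4%:R) by rewrite mulr_ge0 //; lra.
  have q2 : (2%:R * nu ^+ 3) - (nu - 1) * (nu - 2%:R) * (2%:R * nu - 3%:R)
    = 9%:R * (nu * (nu - 4%:R)) + 23%:R * nu + 6%:R by ring.
  by lra.
have p2 := ler_wpM2l d0 p1.
have p3 : 0 <= (r - r') * nu ^+ 3 by rewrite mulr_ge0 ?subr_ge0 // exprn_ge0 // ler0n.
lra.
Qed.

(** A positive entry of the Perron vector and [q > 0] force some triangle sum to be positive, so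
    dividing by the largest one is legitimate. *)
Lemma normalized_perron K : (0 < t)%N -> complexes2 R t K ->
  0 < signless_radius R K ->
  exists f : 'I_n -> 'I_n -> R,
  [/\ forall x y, f x y = f y x, forall x y, 0 <= f x y,
      forall x y, signless_radius R K * f x y
        = \sum_z face_wt R (tau K) x y z * tri f x y z
    & forall x y z, tau K x y z -> tri f x y z <= 1] /\
  exists x y z, tau K x y z /\ tri f x y z = 1.
Proof.
move=> t0 K2 q0; have [hK _ _ _] := K2.
have [f [fC f0 [x [y fxy]] eig]] := perron_pairs R hK (complexes2_edge t0 K2).
have [z [txyz gpos]] : exists z, tau K x y z /\ 0 < tri f x y z.
  have : 0 < \sum_z face_wt R (tau K) x y z * tri f x y z by rewrite -eig mulr_gt0.
  have [[z /andP[tz gz]]|nz] := pselect (exists z, tau K x y z && (0 < tri f x y z));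
    first by exists z.
  rewrite big1 ?ltxx // => z _; rewrite /face_wt; case: (boolP (tau K x y z)) => tz;
    last by rewrite mul0r.
  apply/eqP; rewrite mul1r eq_le tri_ge0 // andbT leNgt; apply/negP => gz.
  by apply: nz; exists z; rewrite tz.
pose P (p : 'I_n * 'I_n * 'I_n) := tau K p.1.1 p.1.2 p.2.
pose g (p : 'I_n * 'I_n * 'I_n) := tri f p.1.1 p.1.2 p.2.
have Pp : P (x, y, z) by [].
case: (arg_maxP g Pp) => -[[a b] c] tabc gmax.
have mpos : 0 < tri f a b c by apply: lt_le_trans gpos (gmax (x, y, z) Pp).
set m := tri f a b c in mpos.
have triZ u w s : tri (fun x y => f x y / m) u w s = tri f u w s / m.
  by rewrite /tri !mulrDl.
exists (fun x y => f x y / m); split; first split=> [u w|u w|u w|u w s tuws].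
- by rewrite fC.
- by rewrite divr_ge0 // ltW.
- rewrite mulrA eig mulr_suml; apply: eq_bigr => s _.
  by rewrite triZ mulrA.
- by rewrite triZ ler_pdivrMr // mul1r; apply: (gmax (u, w, s)).
by exists a, b, c; split=> //; rewrite triZ divff // gt_eqF.
Qed.

Lemma min_deg_rotation K f x y z : (forall u w, f u w = f w u :> R) ->
  tau K x y z -> tri f x y z = 1 ->
  exists a b c, [/\ tau K a b c, tri f a b c = 1,
    edge_deg R (tau K) b c <= edge_deg R (tau K) a b
    & edge_deg R (tau K) b c <= edge_deg R (tau K) a c].
Proof.
move=> fC txyz g1; have [t12 t23 _] := tau_sym K.
have dC := degC R (tau_sym K).
have [h1|h1] := leP (edge_deg R (tau K) y z) (edge_deg R (tau K) x y);
have [h2|h2] := leP (edge_deg R (tau K) y z) (edge_deg R (tau K) x z).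
- by exists x, y, z; split.
- exists y, x, z; split; [by rewrite t12| | |].
  + by rewrite -g1 /tri (fC y x); ring.
  + by rewrite (dC y x) ltW // (lt_le_trans h2).
  + exact: ltW.
- exists z, x, y; split; [by rewrite t12 t23| | |].
  + by rewrite -g1 /tri (fC z x) (fC z y); ring.
  + by rewrite (dC z x) ltW // (lt_le_trans h1).
  + by rewrite (dC z y) ltW.
have [h3|h3] := leP (edge_deg R (tau K) x y) (edge_deg R (tau K) x z).
  exists z, x, y; split; [by rewrite t12 t23| | |].
  + by rewrite -g1 /tri (fC z x) (fC z y); ring.
  + by rewrite (dC z x).
  + by rewrite (dC z y) ltW.
exists y, x, z; split; [by rewrite t12| | |].
+ by rewrite -g1 /tri (fC y x); ring.
+ by rewrite (dC y x) ltW.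
+ exact: ltW.
Qed.

End Maximizers.

(** The product multiplying [D] is at least [nu * (2 * nu ^ 3 - m * nu ^ 2)]. As [m <= nu], this
    first yields the crude bound [D * nu ^ 3 <= 18 * t * (1 + e)], which then controls the error
    term [m * D * nu ^ 3] in the sharp one. *)
Lemma tent_asymptotics (R : realType) (nu t m e k D : R) :
  0 <= t -> 0 <= e -> 0 <= k -> 4%:R <= nu -> m = 7%:R + 4%:R * k -> m <= nu ->
  9%:R * t <= D * nu ^+ 3 ->
  D * (nu - 2%:R) * (nu - 2%:R * k) * (2%:R * nu - 3%:R) * nu
    <= 18%:R * t * (nu + e) ->
  `|D - 9%:R * t / nu ^+ 3| <= (9%:R * t * e + 9%:R * m * t * (1 + e)) / nu ^+ 4.
Proof.
move=> t0 e0 k0 n4 mE mn lower upper.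
have n0 : 0 < nu by lra.
have n3 : 0 < nu ^+ 3 by rewrite exprn_gt0.
have n34 : 0 < nu ^+ 4 by rewrite exprn_gt0.
have D0 : 0 <= D by rewrite -(pmulr_lge0 _ n3); apply: le_trans lower; rewrite mulr_ge0 // ler0n.
have l0 : 9%:R * t / nu ^+ 3 <= D by rewrite ler_pdivrMr.
rewrite ger0_norm ?subr_ge0 // lerBlDr.
have -> : (9%:R * t * e + 9%:R * m * t * (1 + e)) / nu ^+ 4 + 9%:R * t / nu ^+ 3
   = (9%:R * t * e + 9%:R * m * t * (1 + e) + 9%:R * t * nu) / nu ^+ 4.
  by field; rewrite gt_eqF.
rewrite ler_pdivlMr //.
have r1 : 0 <= D * nu * ((14%:R * k + 6%:R) * nu - 12%:R * k).
  rewrite mulr_ge0 ?(mulr_ge0 D0) //; first by rewrite ltW.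
  have : 0 <= k * (nu - 4%:R) by rewrite mulr_ge0 ?subr_ge0.
  lra.
have u1 : D * nu * (2%:R * nu ^+ 3 - m * nu ^+ 2) <= 18%:R * t * (nu + e).
  rewrite mE; lra.
have r2 : 0 <= D * nu * nu ^+ 2 * (nu - m).
  by rewrite mulr_ge0 ?subr_ge0 // mulr_ge0 ?sqr_ge0 // mulr_ge0 // ltW.
have te : 0 <= t * e by rewrite mulr_ge0.
have r3 : 0 <= t * e * (nu - 1) by rewrite mulr_ge0 // subr_ge0; lra.
have u2 : D * nu ^+ 3 <= 18%:R * t * (1 + e).
  rewrite -(ler_pM2r n0); lra.
have m0 : 0 <= m by lra.
have := ler_wpM2l m0 u2; lra.
Qed.

Theorem theorem4p1 (R : realType) (t : nat) (ht : (1 <= t)%N) :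
  exists (N : nat) (C : R),
    forall n : nat, (N <= n)%N ->
    forall K : {set {set 'I_n}}, maximizer R t K ->
      (exists (v : 'I_n) (L : {set {set 'I_n}}),
          tented_plus v t L /\ isomorphic K L) /\
      `| signless_radius R K
         - (2%:R * n%:R - 3%:R + 9%:R * t%:R / n%:R ^+ 3) | <= C / n%:R ^+ 4.
Proof.
pose k : R := 333%:R + 96%:R * t%:R.
pose k4 : R := 12%:R * k + 14%:R.
pose k5 : R := 24%:R * k + 29%:R.
pose m : R := 7%:R + 4%:R * k5.
pose e : R := 18%:R * t%:R * k4.
(* The most demanding requirement is [big2], which needs [n] to be at least
   [513359 + 147459 * t]. *)
exists (1000 * (1000 * t.+1))%N.
exists (9%:R * t%:R * e + 9%:R * m * t%:R * (1 + e)).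
move=> n nN K Kmax; have [K2 Kle] := Kmax.
have t0 : 0 <= t%:R :> R by rewrite ler0n.
have nu_big : 1000%:R * (1000%:R * (t%:R + 1)) <= n%:R :> R.
  by move: nN; rewrite -(ler_nat R) !natrM natr1.
have k0 : 0 <= k by rewrite /k; lra.
have nu4 : 4%:R <= n%:R :> R by lra.
have nt : 4%:R * t%:R <= n%:R :> R by lra.
have tn : (t + 4 <= n)%N by rewrite -(ler_nat R) natrD; lra.
have n3 : (3 <= n)%N by apply: leq_trans tn; rewrite -[3%N]add0n leq_add.
have n2 : (2 <= n)%N by exact: leq_trans n3.
have lower := maximizer_radius_ge tn ht Kmax.
set q := signless_radius R K in lower *.
have q_ge : 2%:R * n%:R - 3%:R <= q.
  have n30 : 0 < n%:R ^+ 3 :> R by rewrite exprn_gt0 //; lra.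
  by rewrite -subr_ge0 -(pmulr_lge0 _ n30); apply: le_trans lower; rewrite mulr_ge0 // ler0n.
have q0 : 0 < q by lra.
have [f [[fC f0 eig gle] [x [y [z [txyz gxyz]]]]]] := normalized_perron ht K2 q0.
have [v [b [c [tvbc gvbc d1 d2]]]] := min_deg_rotation fC txyz gxyz.
have tsym := tau_sym K.
have tetra a b' c' := @card_tetrahedra_le R n K t a b' c' K2.
have triples := sum_wt_le v n2 K2.
have q_le' := radius_le eig gle tetra tvbc gvbc.
have big1' : 81%:R + 24%:R * t%:R <= n%:R :> R by lra.
have Lv := ldeg_star_ge tsym eig gle tetra triples q_ge nu4 nt tvbc gvbc d1 d2 big1'.
rewrite -/k in Lv.
have big2 : 3%:R * t%:R + 64%:R * (24%:R * k + 29%:R) + 15%:R <= n%:R by rewrite /k; lra.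
have big3 : 9%:R * (12%:R * k + 14%:R) < n%:R by rewrite /k; lra.
(* The competitor [L] has all triangles at [v] and [t] others, chosen among those of [K] avoiding
   [v] or containing all of them. *)
have [A [At A_off AE]] := exchange_triples tn (@off_facesP n v K).
pose L := Defs.generated (tented v :|: A)%SET.
have L2 : complexes2 R t L by rewrite -At; exact: complexes2_generated.
have [hL _ _ _] := L2.
have f_diag := perron_diag tsym eig q_ge nu4.
(* The Perron vector of [K] is tested on [L], whose radius is at most [q] by maximality. *)
have energy : \sum_x \sum_y \sum_z face_wt R (tau L) x y z * tri f x y z ^+ 2
    <= \sum_x \sum_y \sum_z face_wt R (tau K) x y z * tri f x y z ^+ 2.
  rewrite (tau_energy tsym fC eig).
  apply: le_trans (rayleigh_pairs hL (complexes2_edge ht L2) fC f_diag) _.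
  apply: ler_wpM2r; last by rewrite ler_wpM2l ?ler0n // Kle.
  by apply: sumr_ge0 => u _; apply: sumr_ge0 => w _; exact: sqr_ge0.
have count : \sum_(x | x != v) \sum_(y | y != v) \sum_(z | z != v)
    face_wt R (tau K) x y z * (1 - face_wt R (tau L) x y z) <= 3%:R * missing R (tau K) v.
  have -> : \sum_(x | x != v) \sum_(y | y != v) \sum_(z | z != v)
      face_wt R (tau K) x y z * (1 - face_wt R (tau L) x y z)
    = 6%:R * \sum_(F in off_faces v K) (1 - (F \in A)%:R).
    rewrite (eq_bigr (fun F => 1 - (F \in faces 2 L)%:R)) => [|F /off_facesP[_ vF]].
      by rewrite -sum_wt_off.
    by rewrite faces2_generated // !inE (negPf vF) andbF.
  (* If [A] lies inside the outer triangles of [K], all but [t] of them are lost, and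
     [off_sum_le_missing] bounds their number; otherwise none is lost. *)
  have [/fintype.subsetP AE'|EA] := orP AE.
    rewrite sumrB sumr_const.
    have -> : \sum_(F in off_faces v K) (F \in A)%:R = t%:R :> R.
      rewrite -At -sum1_card natr_sum [RHS]big_mkcond /= big_mkcond.
      apply: eq_bigr => F _; case: (boolP (F \in A)) => [/AE'->|_] //.
      by rewrite if_same.
    have := off_sum_le_missing tsym triples v.
    by rewrite off_sum_card; lra.
  rewrite big1 ?mulr0 => [|F FE]; last by rewrite (fintype.subsetP EA _ FE) subrr.
  rewrite mulr_ge0 ?ler0n // (missingE R tsym); apply: sumr_ge0 => u _.
  by apply: sumr_ge0 => w _; rewrite subr_ge0 wt_le1.
have star : forall u w, u != v -> w != v -> w != u -> tau K v u w.
  exact: (star_complete tsym fC f0 eig gle triples q_ge q_le' nu4 nt tvbc gvbc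
    k0 Lv big2 (tau_sym L) (tented_star A_off) energy count big3).
split.
  (* [K] itself is tented at [v], so the identity serves as relabeling. *)
  exists v, K; split; last exact: isomorphic_refl.
  exact: star_complex_tented_plus n3 K2 star.
rewrite opprD addrA.
apply: (@tent_asymptotics _ _ _ _ _ k5) => //.
- by rewrite /e /k4 mulr_ge0 ?mulr_ge0 ?addr_ge0 ?mulr_ge0 ?ler0n.
- by rewrite /k5 addr_ge0 ?mulr_ge0 ?ler0n.
- by rewrite /m /k5; lra.
exact: (tent_upper_raw tsym fC f0 eig gle triples q_ge nu4 nt tvbc gvbc k0 Lv star).
Qed.
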